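(* Let $W_\alpha$ be a weighted shift with moment sequence $\gamma$. Then $W_\alpha$ is $\mathcal{MID}$ if and only if for each $i\ge0$ and each $k\ge1$, $\log M_\gamma(i,k)$ is CPD (equivalently, both $\log M_\gamma(0)$ and $\log M_\gamma(1)$ are CPD).
   Context: Weighted shifts: given a bounded sequence $\alpha=(\alpha_n)_{n=0}^\infty$ of positive real numbers, $W_\alpha$ is the bounded operator on $\ell^2(\mathbb{N}_0)$ with $W_\alpha e_n=\alpha_n e_{n+1}$ (no contractivity is assumed). Its moments are $\gamma_0:=1$, $\gamma_n:=\prod_{j=0}^{n-1}\alpha_j^2$ for $n\ge 1$. For $p>0$, the Schur power $W_\alpha^p$ denotes the weighted shift with weights $(\alpha_n^p)_{n\ge0}$. An operator is subnormal if it is the restriction of a normal operator to a closed invariant subspace. $W_\alpha$ is moment infinitely divisible ($\mathcal{MID}$) if the Schur power $W_\alpha^p$ is subnormal for every $p>0$. Matrices: $M_\gamma(i,k):=(\gamma_{i+s+t})_{s,t=0}^{k}$, $M_\gamma(0):=(\gamma_{s+t})_{s,t=0}^\infty$, $M_\gamma(1):=(\gamma_{s+t+1})_{s,t=0}^\infty$; $\log$ is taken entrywise. A finite Hermitian matrix $A=(a_{st})$ is conditionally positive definite (CPD) if $\sum_{s,t}a_{st}\bar c_s c_t\ge 0$ for all complex vectors $c$ with $\sum_s c_s=0$. An infinite matrix is CPD if all its finite principal submatrices are. *)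

(* Defs.v *)
From HB Require Import structures.
From mathcomp Require Import all_boot all_order all_algebra.
From mathcomp Require Import complex.
From mathcomp Require Import all_classical all_reals all_analysis.
From mathcomp Require Import ring lra.

Set Implicit Arguments.
Unset Strict Implicit.
Unset Printing Implicit Defensive.

Import Order.TTheory GRing.Theory Num.Theory.
Import numFieldNormedType.Exports.

Local Open Scope classical_set_scope.
Local Open Scope complex_scope.
Local Open Scope ring_scope.

(* Inner products are linear on the left and conjugate-linear on the right. *)
HB.mixin Record CompleteNormedModule_isHilbert (R : realType) H
    & CompleteNormedModule R[i] H := {
  inner : {dot H for (@Num.conj R[i])} ;
  inner_norm : forall x : H, inner x x = `|x| ^+ 2
}.

#[short(type="hilbertType")]
HB.structure Definition Hilbert (R : realType) :=
  {H of CompleteNormedModule_isHilbert R H & CompleteNormedModule R[i] H}.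

Section dot_norm.
Context {R : realType} {U : lmodType R[i]} (f : {dot U for (@Num.conj R[i])}).

Definition dot_norm (x : U) : R[i] := sqrtC (f x x).

Lemma dot_normE x : dot_norm x ^+ 2 = f x x.
Proof. by rewrite /dot_norm sqrtCK. Qed.

Lemma dot_norm_ge0 x : 0 <= dot_norm x.
Proof. by rewrite /dot_norm sqrtC_ge0 dnorm_ge0. Qed.

Lemma dot_norm0_eq0 x : dot_norm x = 0 -> x = 0.
Proof.
by move=> x0; apply/eqP; rewrite -(dnorm_eq0 f) -dot_normE x0 expr0n.
Qed.

Lemma dot_normZ (a : R[i]) x : dot_norm (a *: x) = `|a| * dot_norm x.
Proof.
rewrite /dot_norm dnormZ sqrtCM ?nnegrE ?exprn_ge0 ?dnorm_ge0//.
by rewrite sqrCK.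
Qed.

Lemma dot_normD x y : dot_norm (x + y) <= dot_norm x + dot_norm y.
Proof.
have [x0|x0] := eqVneq (dot_norm x) 0.
  by rewrite x0 (dot_norm0_eq0 x0) !add0r.
have [y0|y0] := eqVneq (dot_norm y) 0.
  by rewrite y0 (dot_norm0_eq0 y0) !addr0.
set a := dot_norm x; set b := dot_norm y.
have a_ge0 : 0 <= a by exact: dot_norm_ge0.
have b_ge0 : 0 <= b by exact: dot_norm_ge0.
have ab_gt0 : 0 < a * b by rewrite mulr_gt0// lt0r ?x0 ?y0.
have ca : a^* = a by apply/CrealP/ger0_real.
have cb : b^* = b by apply/CrealP/ger0_real.
have ab : f x y + f y x <= 2 * (a * b).
  rewrite -subr_ge0 -(pmulr_rge0 _ ab_gt0).
  suff -> : a * b * (2 * (a * b) - (f x y + f y x))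
            = f (b *: x - a *: y) (b *: x - a *: y) by exact: dnorm_ge0.
  have El z : f (b *: x - a *: y) z = b * f x z - a * f y z.
    by rewrite linearBl /= !linearZl_LR.
  have Er z : f z (b *: x - a *: y) = b * f z x - a * f z y.
    by rewrite linearBr /= !linearZr_LR /= ca cb.
  by rewrite El !Er -!dot_normE -/a -/b; ring.
rewrite -(@ler_pXn2r _ 2) ?nnegrE ?addr_ge0 ?dot_norm_ge0//.
rewrite dot_normE linearDl !linearDr /= -!dot_normE -/a -/b.
rewrite -subr_ge0.
rewrite (_ : _ - _ = 2 * (a * b) - (f x y + f y x)); last by ring.
by rewrite subr_ge0.
Qed.

End dot_norm.

Section ell2.
Variable R : realType.
Local Notation C := R[i].
Implicit Types (x y z u v : nat -> C) (a b : C).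

Definition square_summable x :=
  cvgn (series (fun n => Normc.normc (x n) ^+ 2)).

(* a complex series is summed on real and imaginary parts *)
Definition csum u : C :=
  limn (series (fun n => complex.Re (u n))) +i*
  limn (series (fun n => complex.Im (u n))).

Definition csummable u := cvgn (series (fun n => Normc.normc (u n))).

Lemma normc_ge0 a : 0 <= Normc.normc a.
Proof. by case: a => ? ? /=; rewrite sqrtr_ge0. Qed.

Lemma sqr_normcE a :
  Normc.normc a ^+ 2 = complex.Re a ^+ 2 + complex.Im a ^+ 2.
Proof. by case: a => ? ? /=; rewrite sqr_sqrtr// addr_ge0 ?sqr_ge0. Qed.

Lemma normcJ a : Normc.normc a^* = Normc.normc a.
Proof. by case: a => ? ? /=; rewrite sqrrN. Qed.

Lemma le_Re_normc a : `|complex.Re a| <= Normc.normc a.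
Proof.
by rewrite -ler_sqr ?nnegrE ?normc_ge0// sqr_normcE real_normK ?num_real// lerDl
  sqr_ge0.
Qed.

Lemma le_Im_normc a : `|complex.Im a| <= Normc.normc a.
Proof.
by rewrite -ler_sqr ?nnegrE ?normc_ge0// sqr_normcE real_normK ?num_real// lerDr
  sqr_ge0.
Qed.

Lemma csummable_Re u :
  csummable u -> cvgn (series (fun n => complex.Re (u n))).
Proof.
move=> cu; apply: (@normed_cvg R R^o); apply: series_le_cvg cu => n //=.
- exact: normc_ge0.
- exact: le_Re_normc.
Qed.

Lemma csummable_Im u :
  csummable u -> cvgn (series (fun n => complex.Im (u n))).
Proof.
move=> cu; apply: (@normed_cvg R R^o); apply: series_le_cvg cu => n //=.
- exact: normc_ge0.
- exact: le_Im_normc.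
Qed.

Lemma lim_series_lin (a b : R) (u v w : nat -> R) :
  cvgn (series u) -> cvgn (series v) -> cvgn (series w) ->
  limn (series (fun n => a * u n + b * v n + w n)) =
  a * limn (series u) + b * limn (series v) + limn (series w).
Proof.
move=> cu cv cw.
have -> : series (fun n => a * u n + b * v n + w n) =
    (fun n => a * series u n + b * series v n + series w n).
  by apply/funext => n; rewrite /series /= !big_split /= -!mulr_sumr.
apply: cvg_lim => //.
apply: cvgD => //; apply: cvgD; apply: cvgM => //; exact: cvg_cst.
Qed.

Lemma csumP a u v : csummable u -> csummable v ->
  csum (fun n => a * u n + v n) = a * csum u + csum v.
Proof.
move=> cu cv.
have [cur cui cvr cvi] : [/\ cvgn (series (fun n => complex.Re (u n))),
    cvgn (series (fun n => complex.Im (u n))),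
    cvgn (series (fun n => complex.Re (v n))) &
    cvgn (series (fun n => complex.Im (v n)))].
  by split; do [exact: csummable_Re cu|exact: csummable_Im cu|
    exact: csummable_Re cv|exact: csummable_Im cv].
rewrite /csum.
case: a => a1 a2.
have -> : (fun n => complex.Re ((a1 +i* a2) * u n + v n)) =
    (fun n => a1 * complex.Re (u n) + (- a2) * complex.Im (u n)
              + complex.Re (v n)).
  by apply/funext => n; case: (u n) (v n) => ? ? [? ?] /=; rewrite mulNr.
have -> : (fun n => complex.Im ((a1 +i* a2) * u n + v n)) =
    (fun n => a1 * complex.Im (u n) + a2 * complex.Re (u n)
              + complex.Im (v n)).
  by apply/funext => n; case: (u n) (v n) => ? ? [? ?].
by rewrite !lim_series_lin// mulNr.
Qed.

Lemma csumJ u : csummable u -> csum (fun n => (u n)^*) = (csum u)^*.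
Proof.
move=> cu; rewrite /csum.
have -> : (fun n => complex.Re (u n)^*) = (fun n => complex.Re (u n)).
  by apply/funext => n; case: (u n).
have -> : (fun n => complex.Im (u n)^*) = - (fun n => complex.Im (u n)).
  by apply/funext => n; rewrite -[RHS]/(- complex.Im (u n)); case: (u n).
by rewrite lim_seriesN//; exact: csummable_Im.
Qed.

Lemma summable_mulJ x y : square_summable x -> square_summable y ->
  csummable (fun n => x n * (y n)^*).
Proof.
move=> cx cy; have := is_cvg_seriesD cx cy; apply: series_le_cvg => n.
- exact: normc_ge0.
- by rewrite addr_ge0 ?sqr_ge0.
- rewrite Normc.normcM normcJ.
  set s := Normc.normc _; set t := Normc.normc _.
  rewrite -[leRHS]/(s ^+ 2 + t ^+ 2); have := sqr_ge0 (s - t).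
  have : 0 <= s * t by rewrite mulr_ge0 ?normc_ge0.
  nra.
Qed.

Lemma le_normcD_sqr a b : Normc.normc (a + b) ^+ 2 <=
  2 * (Normc.normc a ^+ 2 + Normc.normc b ^+ 2).
Proof.
rewrite !sqr_normcE; case: a b => a1 a2 [b1 b2] /=.
have := sqr_ge0 (a1 - b1); have := sqr_ge0 (a2 - b2); nra.
Qed.

Lemma is_cvg_series_mul (k : R) (u : nat -> R) :
  cvgn (series u) -> cvgn (series (fun n => k * u n)).
Proof.
move=> cu.
have -> : series (fun n => k * u n) = (fun n => k * series u n).
  by apply/funext => n; rewrite /series /= mulr_sumr.
by apply: is_cvgM => //; exact: is_cvg_cst.
Qed.

Lemma square_summableD x y :
  square_summable x -> square_summable y -> square_summable (x + y).
Proof.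
move=> cx cy; have := is_cvg_series_mul (k := 2) (is_cvg_seriesD cx cy).
apply: series_le_cvg => n.
- exact: sqr_ge0.
- by rewrite mulr_ge0// addr_ge0 ?sqr_ge0.
- exact: le_normcD_sqr.
Qed.

Lemma square_summableZ a x : square_summable x -> square_summable (a *: x).
Proof.
move=> cx; rewrite /square_summable.
have -> : (fun n => Normc.normc ((a *: x) n) ^+ 2) =
    (fun n => Normc.normc a ^+ 2 * Normc.normc (x n) ^+ 2).
  by apply/funext => n; rewrite -exprMn -Normc.normcM.
exact: is_cvg_series_mul.
Qed.

Definition ell2_pred : {pred nat -> C} := fun x => `[< square_summable x >].

Lemma ell2_submod_closed : submod_closed ell2_pred.
Proof.
split=> [|a x y /asboolP sx /asboolP sy]; apply/asboolP.
  rewrite /square_summable (_ : series _ = cst 0); first exact: is_cvg_cst.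
  by apply/funext => n; apply: big1 => i _; rewrite Normc.normc0 expr0n.
by apply: square_summableD => //; exact: square_summableZ.
Qed.

HB.instance Definition _ :=
  GRing.isSubmodClosed.Build _ _ ell2_pred ell2_submod_closed.

Record ell2 := Ell2 { ell2_val :> nat -> C ; _ : ell2_val \in ell2_pred }.

HB.instance Definition _ := [isSub for ell2_val].
HB.instance Definition _ := [Choice of ell2 by <:].
HB.instance Definition _ := [SubChoice_isSubLmodule of ell2 by <:].

Lemma ell2P (x : ell2) : square_summable x.
Proof. exact/asboolP/(valP x). Qed.
Arguments ell2P : clear implicits.

Lemma ell2_mulJ (x y : ell2) : csummable (fun n => x n * (y n)^*).
Proof. exact: (summable_mulJ (ell2P x) (ell2P y)). Qed.

Definition ell2_inner (x y : ell2) : C := csum (fun n => x n * (y n)^*).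

Lemma ell2_innerP (z : ell2) : linear_for *%R (ell2_inner ^~ z).
Proof.
move=> a x y; rewrite /ell2_inner -csumP; last 2 first.
- exact: ell2_mulJ.
- exact: ell2_mulJ.
by congr csum; apply/funext => n; rewrite mulrA -mulrDl.
Qed.

Lemma ell2_innerC (x y : ell2) : ell2_inner x y = (ell2_inner y x)^*.
Proof.
rewrite /ell2_inner -csumJ; last exact: ell2_mulJ.
by congr csum; apply/funext => n; rewrite rmorphM /= conjCK mulrC.
Qed.

Lemma ell2_inner_norm (x : ell2) :
  ell2_inner x x = (limn (series (fun n => Normc.normc (x n) ^+ 2)))%:C.
Proof.
rewrite /ell2_inner /csum.
have -> : (fun n => complex.Re (x n * (x n)^*)) =
    (fun n => Normc.normc (x n) ^+ 2).
  by apply/funext => n; rewrite sqr_normcE; case: (x n) => p q /=; ring.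
have -> : (fun n => complex.Im (x n * (x n)^*)) = (fun=> 0).
  by apply/funext => n; case: (x n) => p q /=; ring.
congr Complex; rewrite (_ : series _ = cst 0) ?lim_cst//.
by apply/funext => n; rewrite /series /= big1.
Qed.

Lemma ell2_partial_le (x : ell2) N :
  series (fun n => Normc.normc (x n) ^+ 2) N <=
  limn (series (fun n => Normc.normc (x n) ^+ 2)).
Proof.
apply: nondecreasing_cvgn_le; last exact: ell2P.
by apply: nondecreasing_series => n _ _; exact: sqr_ge0.
Qed.

Lemma ell2_coord_le (x : ell2) n :
  (Normc.normc (x n) ^+ 2)%:C <= ell2_inner x x.
Proof.
rewrite ell2_inner_norm lecR (le_trans _ (ell2_partial_le x n.+1))//.
rewrite /series /= big_nat_recr//= lerDr sumr_ge0// => i _; exact: sqr_ge0.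
Qed.

Lemma ell2_inner_gt0 (x : ell2) : x != 0 -> 0 < ell2_inner x x.
Proof.
move=> x0; rewrite lt0r; apply/andP; split; last first.
  rewrite (le_trans _ (ell2_coord_le x 0))// lecR; exact: sqr_ge0.
apply: contra x0 => /eqP xx0; apply/eqP/val_inj/funext => n.
have := ell2_coord_le x n; rewrite xx0 lecR => le0.
apply: Normc.eq0_normc; apply/eqP.
by rewrite -sqrf_eq0 eq_le le0 sqr_ge0.
Qed.

Lemma ell2_innerPr (z : ell2) :
  linear_for ((@Num.conj C) \; *%R) (ell2_inner z).
Proof.
move=> a x y; rewrite ell2_innerC ell2_innerP rmorphD rmorphM /=.
by rewrite -!ell2_innerC.
Qed.

HB.instance Definition _ := bilinear_isBilinear.Build C ell2 ell2 C
  (GRing.Scale.Law.clone _ _ *%R _)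
  (GRing.Scale.Law.clone _ _ ((@Num.conj C) \; *%R) _)
  ell2_inner (ell2_innerP, ell2_innerPr).

Lemma ell2_inner_hermitian (x y : ell2) :
  ell2_inner x y = (-1) ^+ false * (ell2_inner y x)^*.
Proof. by rewrite expr0 mul1r -ell2_innerC. Qed.

HB.instance Definition _ := isHermitianSesquilinear.Build C ell2
  false (@Num.conj C) ell2_inner ell2_inner_hermitian.

HB.instance Definition _ := isDotProduct.Build C ell2
  ell2_inner ell2_inner_gt0.

HB.instance Definition _ := Lmodule_isNormed.Build C ell2
  (dot_normD ell2_inner) (dot_normZ ell2_inner)
  (@dot_norm0_eq0 _ _ ell2_inner).

Lemma ell2_normE (x : ell2) : ell2_inner x x = `|x| ^+ 2.
Proof. by rewrite -dot_normE. Qed.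

Lemma ell2_coord_norm (x : ell2) n : (Normc.normc (x n))%:C <= `|x|.
Proof.
rewrite -(@ler_pXn2r _ 2) ?nnegrE//; last by rewrite lecR normc_ge0.
by rewrite -ell2_normE -rmorphXn ell2_coord_le.
Qed.

Lemma ell2_norm_le (x : ell2) (e : R) : 0 <= e ->
  (`|x| <= e%:C) =
  (limn (series (fun n => Normc.normc (x n) ^+ 2)) <= e ^+ 2).
Proof.
move=> e0; rewrite -(@ler_pXn2r _ 2) ?nnegrE ?lecR//.
by rewrite -ell2_normE ell2_inner_norm -rmorphXn lecR.
Qed.

Lemma square_summable_ub x (M : R) :
  (forall N, series (fun n => Normc.normc (x n) ^+ 2) N <= M) ->
  square_summable x.
Proof.
move=> xM; apply: nondecreasing_is_cvgn.
  by apply: nondecreasing_series => n _ _; exact: sqr_ge0.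
by exists M => _ [N _ <-]; exact: xM.
Qed.

Lemma ell2_complete (F : set_system ell2) :
  ProperFilter F -> cauchy F -> cvg F.
Proof.
move=> FF /cauchyP Fc.
have coord (h : C -> R) n : (forall a b, h (a - b) = h a - h b) ->
    (forall c, `|h c| <= Normc.normc c) -> cvg (h ((x : ell2) n) @[x --> F]).
  move=> hB hle; apply: cauchy_cvg; apply: cauchy_exP => e e0.
  have e0C : 0 < e%:C by rewrite ltcR.
  have [x Fx] := Fc _ e0C.
  exists (h (x n)).
  suff : F [set y : ell2 | `|h (x n) - h (y n)| < e] by [].
  apply: filterS Fx => y.
  rewrite -ball_normE /= => xy.
  rewrite -hB (le_lt_trans (hle _))//.
  by rewrite -ltcR (le_lt_trans _ xy)// (ell2_coord_norm (x - y)).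
have ReF n : cvg (complex.Re ((x : ell2) n) @[x --> F]).
  by apply: coord => [[? ?] [? ?]//|]; exact: le_Re_normc.
have ImF n : cvg (complex.Im ((x : ell2) n) @[x --> F]).
  by apply: coord => [[? ?] [? ?]//|]; exact: le_Im_normc.
pose z n : C := lim (complex.Re ((x : ell2) n) @[x --> F]) +i*
                lim (complex.Im ((x : ell2) n) @[x --> F]).
have zbound (x : ell2) (e : R) : 0 < e -> F (ball x e%:C) -> forall N,
    series (fun n => Normc.normc (z n - x n) ^+ 2) N <= e ^+ 2.
  move=> e0 Fx N.
  have cvgN : series (fun n => Normc.normc ((y : ell2) n - x n) ^+ 2) N @[y --> F] -->
      series (fun n => Normc.normc (z n - x n) ^+ 2) N.
    rewrite /series /=; apply: cvg_big => [|n _]; first exact: add_continuous.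
    rewrite sqr_normcE.
    under eq_fun do rewrite sqr_normcE.
    apply: cvgD.
      have -> : complex.Re (z n - x n) = complex.Re (z n) - complex.Re (x n).
        by case: (x n).
      have -> : (fun y : ell2 => complex.Re (y n - x n) ^+ 2) =
          (fun y : ell2 => (complex.Re (y n) - complex.Re (x n)) ^+ 2).
        by apply/funext => y; case: (x n) (y n) => ? ? [].
      by apply: cvgM; apply: cvgB; do ?[exact: cvg_cst|exact: ReF].
    have -> : complex.Im (z n - x n) = complex.Im (z n) - complex.Im (x n).
      by case: (x n).
    have -> : (fun y : ell2 => complex.Im (y n - x n) ^+ 2) =
        (fun y : ell2 => (complex.Im (y n) - complex.Im (x n)) ^+ 2).
      by apply/funext => y; case: (x n) (y n) => ? ? [].
    by apply: cvgM; apply: cvgB; do ?[exact: cvg_cst|exact: ImF].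
  apply: (cvgr_to_le cvgN); apply: filterS Fx => y.
  rewrite -ball_normE /= distrC => /ltW; rewrite (ell2_norm_le _ (ltW e0)).
  by apply: le_trans; exact: (ell2_partial_le (y - x)).
have zell2 : z \in ell2_pred.
  have e0C : 0 < (1 : R)%:C by rewrite ltcR.
  have [x Fx] := Fc _ e0C.
  apply/asboolP; rewrite (_ : z = (z - x) + x); last by rewrite subrK.
  apply: square_summableD; last exact: ell2P.
  exact: (square_summable_ub (zbound _ _ ltr01 Fx)).
apply/cvg_ex; exists (Ell2 zell2).
apply/cvgrPdist_le => e e0.
have /complex_realP [r er] : e \is Num.real by exact: gtr0_real.
have r0 : 0 < r by rewrite -ltcR -er.
have r20 : 0 < r / 2 by rewrite divr_gt0.
have r20C : 0 < (r / 2)%:C by rewrite ltcR.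
have [x Fx] := Fc _ r20C.
apply: filterS (Fx) => y; rewrite -ball_normE /= => /ltW xy.
rewrite er (splitr r) rmorphD /= (le_trans (ler_distD x _ _))// lerD//.
rewrite (ell2_norm_le _ (ltW r20)).
apply: limr_le; first exact: ell2P.
by apply: nearW => N; exact: zbound.
Qed.

HB.instance Definition _ := Uniform_isComplete.Build ell2 ell2_complete.

HB.instance Definition _ := CompleteNormedModule_isHilbert.Build R ell2
  ell2_normE.

End ell2.

Section operators.
Context {R : realType}.
Local Notation C := R[i].

Definition bounded_operator {H K : hilbertType R} (T : H -> K) :=
  exists M : C, forall x, `|T x| <= M * `|x|.

Definition adjoint_of {H : hilbertType R} (T Tstar : H -> H) :=
  forall x y, inner (T x) y = inner x (Tstar y).

Definition normal_operator {H : hilbertType R} (T : {linear H -> H}) :=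
  bounded_operator T /\
  exists Tstar : {linear H -> H},
    adjoint_of T Tstar /\ forall x, T (Tstar x) = Tstar (T x).

(* [H] is identified through the isometry [V] with the closed subspace
   [range V] of [K], which [VS] makes invariant under [N]; [S] is then the
   restriction of [N] to that subspace. *)
Definition subnormal {H : hilbertType R} (S : {linear H -> H}) :=
  exists (K : hilbertType R) (N : {linear K -> K}) (V : {linear H -> K}),
    [/\ normal_operator N,
        forall x y, inner (V x) (V y) = inner x y,
        closed (range V)
      & forall x, V (S x) = N (V x)].

End operators.

Record weight_seq (R : realType) := WeightSeq {
  weight :> nat -> R;
  weight_gt0 : forall n, 0 < weight n;
  weight_bounded : exists M, forall n, weight n <= M
}.

Section weighted_shift.
Context {R : realType}.
Local Notation C := R[i].
Implicit Types a : weight_seq R.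

Definition wshift_fun (a : nat -> R) (x : nat -> C) : nat -> C :=
  fun n => if n is m.+1 then (a m)%:C * x m else 0.

Lemma wshift_subproof a (x : ell2 R) : wshift_fun a x \in @ell2_pred R.
Proof.
apply/asboolP; have [M aM] := weight_bounded a.
apply: (@square_summable_ub _ _
  (M ^+ 2 * limn (series (fun n => Normc.normc (x n) ^+ 2)))) => N.
have M0 : 0 <= M by rewrite (le_trans _ (aM 0%N))// ltW// weight_gt0.
apply: (@le_trans _ _
  (M ^+ 2 * series (fun n => Normc.normc (x n) ^+ 2) N)); last first.
  by rewrite ler_wpM2l ?sqr_ge0//; exact: ell2_partial_le.
rewrite /series /= mulr_sumr; case: N => [|N]; first by rewrite !big_geq.
rewrite big_nat_recl//= [leRHS]big_nat_recr//=.
rewrite [X in X + _](_ : _ = 0) ?add0r; last first.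
  by rewrite -[LHS]/(Normc.normc (0 : C) ^+ 2) Normc.normc0 expr0n.
rewrite -[leLHS]addr0; apply: lerD; last by rewrite mulr_ge0 ?sqr_ge0.
apply: ler_sum => n _.
rewrite -[leLHS]/(Normc.normc ((a n)%:C * x n) ^+ 2).
rewrite Normc.normcM exprMn ler_wpM2r ?sqr_ge0//.
by rewrite sqr_normcE /= expr0n addr0 ler_pXn2r ?nnegrE// ltW// weight_gt0.
Qed.

Definition wshift a (x : ell2 R) : ell2 R := Ell2 (wshift_subproof a x).

Lemma wshift_linear a : linear (wshift a).
Proof.
move=> c x y; apply/val_inj/funext => -[|n].
  by rewrite -[RHS]/(c * 0 + 0) mulr0 addr0.
rewrite -[RHS]/(c * ((a n)%:C * x n) + (a n)%:C * y n).
by rewrite -[LHS]/((a n)%:C * (c * x n + y n)) mulrDr mulrCA.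
Qed.

HB.instance Definition _ a :=
  GRing.isLinear.Build C (ell2 R) (ell2 R) *:%R (wshift a) (wshift_linear a).

Lemma ell2_basis_subproof k : (fun n => (n == k)%:R : C) \in @ell2_pred R.
Proof.
apply/asboolP; apply: (@square_summable_ub _ _ 1) => N; rewrite /series /=.
have [kN|Nk] := ltnP k N.
  rewrite (bigD1_seq k) ?mem_index_iota ?iota_uniq//= eqxx Normc.normc1 expr1n.
  rewrite big1 ?addr0// => n /negbTE ->.
  by rewrite Normc.normc0 expr0n.
rewrite big_nat_cond big1 ?ler01// => n /andP[/andP[_ nN] _].
by rewrite ltn_eqF ?(leq_trans nN)// Normc.normc0 expr0n.
Qed.

Definition ell2_basis k : ell2 R := Ell2 (ell2_basis_subproof k).

Lemma wshift_basis a n :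
  wshift a (ell2_basis n) = (a n)%:C *: ell2_basis n.+1.
Proof.
apply/val_inj/funext => -[|m].
  by rewrite -[RHS]/((a n)%:C * (0 == n.+1)%:R) mulr0.
rewrite -[RHS]/((a n)%:C * (m.+1 == n.+1)%:R).
rewrite -[LHS]/((a m)%:C * (m == n)%:R) eqSS.
by have [->//|] := eqVneq m n; rewrite !mulr0.
Qed.

Lemma schur_power_gt0 a (p : R) n : 0 < a n `^ p.
Proof. by rewrite powR_gt0 ?weight_gt0. Qed.

Lemma schur_power_bounded a (p : R) : 0 < p ->
  exists M, forall n, a n `^ p <= M.
Proof.
move=> p0; have [M aM] := weight_bounded a; exists (M `^ p) => n.
have an0 := ltW (weight_gt0 a n).
by rewrite ge0_ler_powR ?nnegrE ?(ltW p0)// (le_trans an0).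
Qed.

Definition schur_power a (p : R) (p0 : 0 < p) : weight_seq R :=
  WeightSeq (schur_power_gt0 a p) (schur_power_bounded a p0).

Definition MID a :=
  forall (p : R) (p0 : 0 < p), subnormal (wshift (schur_power a p0)).

Definition moment a (n : nat) : R := \prod_(0 <= j < n) a j ^+ 2.

Definition moment_mx a (i k : nat) : 'M[R]_k.+1 :=
  \matrix_(s, t) moment a (i + s + t).

Definition moment_imx a (i : nat) : nat -> nat -> R :=
  fun s t => moment a (s + t + i).

End weighted_shift.

Section cpd.
Context {R : realType}.
Local Notation C := R[i].

Definition cpd n (A : 'M[C]_n) :=
  A \is hermsymmx /\
  forall c : 'I_n -> C, \sum_s c s = 0 ->
    0 <= \sum_s \sum_t A s t * (c s)^* * c t.

(* principal submatrices are indexed by increasing maps [f] *)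
Definition icpd (A : nat -> nat -> C) :=
  forall n (f : 'I_n -> nat), {homo f : s t / (s < t)%N} ->
    cpd (\matrix_(s, t) A (f s) (f t)).

Definition log_mx m n (A : 'M[R]_(m, n)) : 'M[C]_(m, n) :=
  map_mx (fun x => (ln x)%:C) A.

Definition log_imx (A : nat -> nat -> R) : nat -> nat -> C :=
  fun s t => (ln (A s t))%:C.

End cpd.

(* Main.v *)
(* Necessity: if [N] is a normal extension and [v = V e_0], then
   [gamma_(s+t) = <(N*N)^s v, (N*N)^t v>] and
   [gamma_(s+t+1) = <N (N*N)^s v, N (N*N)^t v>], so all Hankel matrices of
   [gamma], and likewise of [gamma^p], are positive semidefinite; on vectors with
   zero sum, [(gamma^p - 1) / p] tends to [log gamma] as [p] tends to 0.

   Sufficiency: by Schoenberg's argument (Schur products and the exponential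
   series), [gamma^p] has positive semidefinite Hankel matrices. The moments
   [m_(2k) = gamma_k], [m_odd = 0] then define a positive functional on
   polynomials. Its orthogonal polynomials yield a bounded Jacobi matrix [J] with
   zero diagonal such that [|J^d e_0|^2 = gamma_d], and the bilateral shift
   tensored with [J], on l^2(Z x Z), is normal and extends the weighted shift
   through [e_d |-> (d, J^d e_0) / sqrt gamma_d]. *)
Require Import Defs.
From HB Require Import structures.
From mathcomp Require Import all_boot all_order all_algebra.
From mathcomp Require Import complex.
From mathcomp Require Import all_classical all_reals all_analysis.
From mathcomp Require Import ring lra zify.

Set Implicit Arguments.
Unset Strict Implicit.
Unset Printing Implicit Defensive.

Import Order.TTheory GRing.Theory Num.Theory.
Import numFieldNormedType.Exports.

Local Open Scope classical_set_scope.
Local Open Scope complex_scope.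
Local Open Scope ring_scope.

(** * Positive semidefinite kernels, Schur products and exponentials *)

Section kernels.
Context {R : realType}.
Implicit Types (A B : nat -> nat -> R) (c : nat -> R).

Lemma quadratic_discr (a l q : R) : 0 <= a ->
  (forall x, 0 <= q + 2 * x * l + x ^+ 2 * a) -> l ^+ 2 <= a * q.
Proof.
move=> a0 H; have [a1|] := ltP 0 a.
  (* The quadratic is tested at its minimiser. *)
  have := H (- l / a).
  have -> : q + 2 * (- l / a) * l + (- l / a) ^+ 2 * a = (a * q - l ^+ 2) / a.
    by field; rewrite gt_eqF.
  by rewrite pmulr_lge0 ?invr_gt0// subr_ge0.
move=> a1; have {}a0 : a = 0 by apply/le_anti; rewrite a0 a1.
rewrite a0 mul0r; have [->|l0] := eqVneq l 0; first by rewrite expr0n.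
(* For [a = 0] the expression is affine in [x]; this point makes it equal to -1. *)
have := H (- (q + 1) / (2 * l)); rewrite a0.
have -> : q + 2 * (- (q + 1) / (2 * l)) * l + (- (q + 1) / (2 * l)) ^+ 2 * 0 = -1.
  by field.
by lra.
Qed.

(** Kernels live on all of [nat] and the size enters only through the sums, so passing between sizes
    needs no casts of ordinals. *)
Definition kform n A c : R := \sum_(s < n) \sum_(t < n) A s t * c s * c t.

Definition psd n A := forall c, 0 <= kform n A c.

Lemma eq_kform n A B c : (forall s t, (s < n)%N -> (t < n)%N -> A s t = B s t) ->
  kform n A c = kform n B c.
Proof.
by move=> AB; apply: eq_bigr => s _; apply: eq_bigr => t _; rewrite AB.
Qed.

Lemma kformD n A B c :
  kform n (fun s t => A s t + B s t) c = kform n A c + kform n B c.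
Proof.
rewrite -big_split; apply: eq_bigr => s _; rewrite -big_split.
by apply: eq_bigr => t _; rewrite /= !mulrDl.
Qed.

Lemma kformZ n k A c : kform n (fun s t => k * A s t) c = k * kform n A c.
Proof.
rewrite mulr_sumr; apply: eq_bigr => s _; rewrite mulr_sumr.
by apply: eq_bigr => t _; rewrite /= !mulrA.
Qed.

Lemma kform_rank1 n (v : nat -> R) A c :
  kform n (fun s t => v s * v t * A s t) c = kform n A (fun s => v s * c s).
Proof. by apply: eq_bigr => s _; apply: eq_bigr => t _; ring. Qed.

Lemma kform_outer n (u v : nat -> R) c :
  kform n (fun s t => u s * v t) c =
  (\sum_(s < n) u s * c s) * (\sum_(t < n) v t * c t).
Proof.
rewrite mulr_suml; apply: eq_bigr => s _; rewrite mulr_sumr.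
by apply: eq_bigr => t _; ring.
Qed.

Lemma kform_lastrow n A c : (forall s, A s n = 0) -> (forall s, A n s = 0) ->
  kform n.+1 A c = kform n A c.
Proof.
move=> A0 A1; rewrite /kform big_ord_recr /= [X in _ + X]big1 ?addr0; last first.
  by move=> t _; rewrite A1 !mul0r.
by apply: eq_bigr => s _; rewrite big_ord_recr /= A0 !mul0r addr0.
Qed.

(** Moving [c] along the last coordinate gives a quadratic polynomial in [x], to which
    [quadratic_discr] applies. *)
Lemma kform_delta n A c x : (forall s t, A s t = A t s) ->
  kform n.+1 A (fun s => c s + x * (s == n)%:R) =
  kform n.+1 A c + 2 * x * (\sum_(s < n.+1) A s n * c s) + x ^+ 2 * A n n.
Proof.
move=> Asym.
have dn (F : nat -> R) : \sum_(t < n.+1) F t * ((t : nat) == n)%:R = F n.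
  rewrite big_ord_recr /= eqxx mulr1 big1 ?add0r// => t _.
  by rewrite ltn_eqF ?mulr0.
transitivity (\sum_(s < n.+1) \sum_(t < n.+1) (A s t * c s * c t +
   x * (A s t * c s) * ((t : nat) == n)%:R + x * ((s : nat) == n)%:R * (A s t * c t) +
   x ^+ 2 * ((s : nat) == n)%:R * A s t * ((t : nat) == n)%:R)).
  by apply: eq_bigr => s _; apply: eq_bigr => t _; ring.
transitivity (kform n.+1 A c + \sum_(s < n.+1) (x * (A s n * c s) +
  (x * (\sum_(t < n.+1) A s t * c t) + x ^+ 2 * A s n) * ((s : nat) == n)%:R)).
  rewrite -big_split; apply: eq_bigr => s _; rewrite !big_split /=.
  rewrite (dn (fun t => x * (A s t * c s))).
  rewrite (dn (fun t => x ^+ 2 * ((s : nat) == n)%:R * A s t)).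
  by rewrite -mulr_sumr; ring.
rewrite big_split /=.
rewrite (dn (fun s => x * (\sum_(t < n.+1) A s t * c t) + x ^+ 2 * A s n)).
have -> : \sum_(t < n.+1) A n t * c t = \sum_(t < n.+1) A t n * c t.
  by apply: eq_bigr => t _; rewrite Asym.
by rewrite -mulr_sumr; ring.
Qed.

Lemma psd_diag_ge0 n A : (forall s t, A s t = A t s) -> psd n.+1 A -> 0 <= A n n.
Proof.
move=> Asym Apsd; have := Apsd (fun s => 0 + 1 * (s == n)%:R); rewrite kform_delta//.
rewrite /kform big1 => [|s _]; last by rewrite big1 // => t _; rewrite mulr0.
by rewrite big1 => [|s _]; rewrite ?mulr0 ?addr0 ?add0r ?expr1n ?mul1r.
Qed.

Lemma psd_CauchySchwarz n A c : (forall s t, A s t = A t s) -> psd n.+1 A ->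
  (\sum_(s < n.+1) A s n * c s) ^+ 2 <= A n n * kform n.+1 A c.
Proof.
move=> Asym Apsd.
apply: quadratic_discr => [|x]; first exact: psd_diag_ge0.
by rewrite -kform_delta.
Qed.

Lemma kform_widen n A c : kform n.+1 A (fun s => (s < n)%N%:R * c s) = kform n A c.
Proof.
rewrite /kform big_ord_recr /= [X in _ + X]big1 ?addr0; last first.
  by move=> t _; rewrite ltnn mul0r mulr0 mul0r.
apply: eq_bigr => s _; rewrite big_ord_recr /= ltnn mul0r mulr0 addr0.
by apply: eq_bigr => t _; rewrite !ltn_ord !mul1r.
Qed.

Lemma psd_le n A : psd n.+1 A -> psd n A.
Proof.
by move=> Apsd c; rewrite -kform_widen; exact: Apsd.
Qed.

(* Subtracting the rank-one matrix [A s n * A n t / A n n] leaves a psd kernel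
   with vanishing last row (also when [A n n = 0], where the quotient is [0]). *)
Lemma psd_mul n A B : (forall s t, A s t = A t s) -> (forall s t, B s t = B t s) ->
  psd n A -> psd n B -> psd n (fun s t => A s t * B s t).
Proof.
elim: n A B => [|n IH] A B Asym Bsym Apsd Bpsd c; first by rewrite /kform big_ord0.
pose A' s t := if (s < n.+1)%N && (t < n.+1)%N then
   A s t - A s n * A t n / A n n else 0.
have CS := psd_CauchySchwarz _ Asym Apsd.
have Ann := psd_diag_ge0 Asym Apsd.
have A'psd : psd n.+1 A'.
  move=> d; rewrite (@eq_kform _ _ (fun s t => A s t + (- (A n n)^-1) * (A s n * A t n))).
    rewrite kformD kformZ (kform_outer _ (A^~ n)) mulNr subr_ge0.
    have [->|A0] := eqVneq (A n n) 0; first by rewrite invr0 mul0r; exact: Apsd.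
    by rewrite mulrC ler_pdivrMr ?lt0r ?A0// -expr2 [leRHS]mulrC; exact: CS.
  by move=> s t sn tn; rewrite /A' sn tn /=; ring.
(* If [A n n = 0], Cauchy-Schwarz forces the whole last column to vanish. *)
have Asn s : (s < n.+1)%N -> A n n = 0 -> A s n = 0.
  move=> sn A0; have := CS (fun t => (t == s)%:R); rewrite A0 mul0r.
  rewrite (bigD1 (Ordinal sn)) //= eqxx mulr1 big1 ?addr0.
    by move=> h; apply/eqP; rewrite -sqrf_eq0 eq_le h sqr_ge0.
  by move=> i; rewrite -val_eqE /= => /negbTE ->; rewrite mulr0.
(* The Schur product splits accordingly: a smaller kernel covered by induction, and a nonnegative
   multiple of a diagonal congruence of [B]. *)
have -> : kform n.+1 (fun s t => A s t * B s t) c =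
   kform n.+1 (fun s t => A' s t * B s t) c +
   kform n.+1 (fun s t => (A n n)^-1 * (A s n * A t n * B s t)) c.
  rewrite -kformD; apply: eq_kform => s t sn tn; rewrite /A' sn tn /=; ring.
rewrite kformZ (kform_rank1 _ (A^~ n)); apply: addr_ge0; last first.
  by apply: mulr_ge0; [rewrite invr_ge0|exact: Bpsd].
rewrite kform_lastrow; first apply: IH => //; try exact: psd_le.
- by move=> s t; rewrite /A' andbC Asym; case: ifP => // _; rewrite (mulrC (A s n)).
- move=> s; rewrite /A' ltnS leqnn andbT; case: ifP => [sn|]; last by rewrite mul0r.
  have [A0|A0] := eqVneq (A n n) 0; last by rewrite mulfK ?subrr ?mul0r.
  by rewrite (Asn _ sn A0) !mul0r subrr mul0r.
- move=> t; rewrite /A' ltnS leqnn /=; case: ifP => [sn|]; last by rewrite mul0r.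
  rewrite (Asym n t); have [A0|A0] := eqVneq (A n n) 0.
    by rewrite (Asn _ sn A0) mulr0 mul0r subrr mul0r.
  by rewrite mulrAC mulfV// mul1r subrr mul0r.
Qed.

(** Powers are psd by [psd_mul], partial sums of the exponential series are nonnegative combinations
    of them, and positivity passes to the limit. *)
Lemma psd_exp n A : (forall s t, A s t = A t s) ->
  psd n A -> psd n (fun s t => expR (A s t)).
Proof.
move=> Asym Apsd c.
have powpsd k : psd n (fun s t => A s t ^+ k).
  elim: k => [|k IH].
    move=> d; rewrite (@eq_kform _ _ (fun s t => 1 * 1)) ?kform_outer -?expr2 ?sqr_ge0//.
    by move=> *; rewrite expr0 ?expr1n ?mulr1.
  move=> d; rewrite (@eq_kform _ _ (fun s t => A s t * A s t ^+ k)); last first.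
    by move=> *; rewrite exprS.
  by apply: psd_mul => // s t; rewrite Asym.
have H : (fun N => kform n (fun s t => series (exp_coeff (A s t)) N) c) @ \oo -->
  kform n (fun s t => expR (A s t)) c.
  apply: cvg_big => [|s _]; first exact: add_continuous.
  apply: cvg_big => [|t _]; first exact: add_continuous.
  do 2![apply: cvgM; last exact: cvg_cst].
  exact: is_cvg_series_exp_coeff.
rewrite -(cvg_lim _ H)//; apply: limr_ge; first by apply/cvg_ex; eexists; exact: H.
apply: nearW => N.
elim: N => [|N IH]; last first.
  rewrite (@eq_kform _ _ (fun s t => series (exp_coeff (A s t)) N + N`!%:R^-1 * A s t ^+ N)).
    by rewrite kformD kformZ addr_ge0// mulr_ge0 ?invr_ge0//; exact: powpsd.
  by move=> s t _ _; rewrite /series /= big_nat_recr//= /exp_coeff mulrC.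
rewrite (@eq_kform _ _ (fun s t => 0 * A s t)) ?kformZ ?mul0r//.
by move=> *; rewrite /series /= big_geq// mul0r.
Qed.
End kernels.

(** * Schoenberg's correspondence between conditional positivity and exponentials *)

Section cpd_kernels.
Context {R : realType}.
Implicit Types (A : nat -> nat -> R) (c : nat -> R).

Definition cpd_kernel n A :=
  forall c, \sum_(s < n) c s = 0 -> 0 <= kform n A c.

(** Centring [A] at the index 0 gives a psd kernel [B]; [p * A] differs from [B] by a function of
    [s] plus one of [t], which exponentiates to a diagonal congruence. *)
Lemma cpd_kernel_exp n A (p : R) : (forall s t, A s t = A t s) -> 0 <= p ->
  cpd_kernel n A -> psd n (fun s t => expR (p * A s t)).
Proof.
case: n => [|n] Asym p0 Acpd; first by move=> c; rewrite /kform big_ord0.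
pose B s t := p * (A s t - A s 0%N - A t 0%N + A 0%N 0%N).
have Bpsd : psd n.+1 B.
  (* [c'] corrects the coefficient at 0 to make the sum vanish; since [B] vanishes when an index is
     0, the form is unchanged. *)
  move=> c; pose c' s := c s - (\sum_(t < n.+1) c t) * (s == 0)%N%:R.
  have c'0 : \sum_(s < n.+1) c' s = 0.
    rewrite sumrB -mulr_sumr [X in _ * X]big_ord_recl /= [X in 1 + X]big1//.
    by rewrite addr0 mulr1 subrr.
  have -> : kform n.+1 B c = kform n.+1 B c'.
    apply: eq_bigr => s _; apply: eq_bigr => t _; rewrite /c'.
    have [s0|s0] := eqVneq (s : nat) 0; first by rewrite s0 /B (Asym 0%N t); ring.
    have [t0|t0] := eqVneq (t : nat) 0; first by rewrite t0 /B; ring.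
    by rewrite !mulr0 !subr0.
  rewrite kformZ mulr_ge0//.
  pose v s := A s 0%N - A 0%N 0%N.
  rewrite (@eq_kform _ _ _ (fun s t => A s t + (- 1) * (v s * 1 + 1 * A t 0%N))); last first.
    by move=> s t _ _; rewrite /v; ring.
  rewrite kformD kformZ kformD (kform_outer _ v (fun=> 1)).
  rewrite (kform_outer _ (fun=> 1) (A^~ 0%N)).
  have -> : \sum_(t < n.+1) 1 * c' t = 0.
    by rewrite -[RHS]c'0; apply: eq_bigr => t _; rewrite mul1r.
  by rewrite mulr0 mul0r addr0 mulr0 addr0; exact: Acpd.
have Bsym s t : B s t = B t s by rewrite /B (Asym s t); ring.
move=> c; pose v s := expR (p * (A s 0%N - A 0%N 0%N / 2)).
rewrite (@eq_kform _ _ _ (fun s t => v s * v t * expR (B s t))).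
  by rewrite kform_rank1; exact: psd_exp.
by move=> s t _ _; rewrite -!expRD; congr expR; rewrite /B; field.
Qed.

(** [(exp (p A) - 1) / p] tends to [A] as [p] decreases to 0, and the constant kernel subtracted
    here contributes nothing on vectors of zero sum. *)
Lemma cpd_kernel_of_exp n A :
  (forall p : R, 0 < p -> psd n (fun s t => expR (p * A s t))) -> cpd_kernel n A.
Proof.
move=> Aexp c c0.
have H : kform n (fun s t => p^-1 * (expR (p * A s t) - 1)) c @[p --> 0^'+] -->
    kform n A c.
  apply: cvg_big => [|s _]; first exact: add_continuous.
  apply: cvg_big => [|t _]; first exact: add_continuous.
  do 2![apply: cvgM; last exact: cvg_cst].
  (* Entrywise the limit is a derivative at 0, restricted to positive increments. *)
  have [] : is_derive (0 : R) 1 (expR \o *%R (A s t)) (expR (A s t * 0) * (A s t * 1)).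
    by apply: is_derive1_comp.
  rewrite mulr0 expR0 mul1r mulr1 => dA dE.
  apply: cvg_dnbhs_at_right.
  rewrite -[X in _ --> X]dE; apply: cvg_trans dA.
  apply: near_eq_cvg; near=> h.
  by rewrite /= mulr0 expR0 addr0 /GRing.scale /= mulr1 [A s t * h]mulrC.
apply: (cvgr_to_ge H).
near=> p.
have p0 : 0 < p by [].
rewrite kformZ mulr_ge0 ?invr_ge0 ?(ltW p0)//.
rewrite (@eq_kform _ _ _ (fun s t => expR (p * A s t) + (-1) * (1 * 1))); last first.
  by move=> s t _ _; ring.
rewrite kformD kformZ (kform_outer _ (fun=> 1) (fun=> 1)).
have -> : \sum_(t < n) 1 * c t = 0.
  by rewrite -[RHS]c0; apply: eq_bigr => t _; rewrite mul1r.
by rewrite !mulr0 addr0; exact: Aexp.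
Unshelve. all: by end_near.
Qed.

End cpd_kernels.

(** * Complex test vectors and pullbacks of index sets *)

Section cpd_real.
Context {R : realType}.
Implicit Types (A : nat -> nat -> R) (c : nat -> R).

Lemma cpd_kernel_le n A : cpd_kernel n.+1 A -> cpd_kernel n A.
Proof.
move=> Acpd c c0; have := Acpd (fun s => (s < n)%N%:R * c s).
rewrite big_ord_recr /= ltnn mul0r addr0.
under eq_bigr do rewrite ltn_ord mul1r.
by move=> /(_ c0); rewrite kform_widen.
Qed.

(** The coefficients are pushed forward along [f], those of indices with a common value being added;
    sum and quadratic form are preserved. *)
Lemma cpd_kernel_comp n (f : nat -> nat) A : (forall k, cpd_kernel k A) ->
  cpd_kernel n (fun s t => A (f s) (f t)).
Proof.
move=> Acpd c c0; pose K := (\max_(s < n) f s).+1.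
pose c' (x : nat) := \sum_(s < n) c s * (f s == x)%:R.
have push (F : nat -> R) : \sum_(x < K) F x * c' x = \sum_(s < n) F (f s) * c s.
  under eq_bigr do rewrite mulr_sumr.
  rewrite exchange_big; apply: eq_bigr => s _.
  have fsK : (f s < K)%N by rewrite ltnS (leq_bigmax s).
  rewrite (bigD1 (Ordinal fsK))//= eqxx mulr1 big1 ?addr0// => x.
  by rewrite -val_eqE /= eq_sym => /negbTE ->; rewrite !mulr0.
have c'0 : \sum_(x < K) c' x = 0.
  rewrite -[RHS]c0; have := push (fun=> 1).
  under eq_bigr do rewrite mul1r.
  by under [X in _ = X -> _]eq_bigr do rewrite mul1r.
have := Acpd K c' c'0; congr (0 <= _); rewrite /kform.
under eq_bigr => x _ do rewrite (push (fun y => A x y * c' x)).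
rewrite exchange_big [RHS]exchange_big; apply: eq_bigr => t _ /=.
transitivity (\sum_(x < K) (A x (f t) * c t) * c' x).
  by apply: eq_bigr => x _; ring.
by rewrite (push (fun x => A x (f t) * c t)); apply: eq_bigr => x _; ring.
Qed.

Lemma sum_complex n (f g : 'I_n -> R) :
  \sum_(i < n) (f i +i* g i) = (\sum_(i < n) f i) +i* (\sum_(i < n) g i).
Proof. by elim/big_rec3: _ => // i x y z _ ->. Qed.

(** On [c = u + iv] the imaginary part cancels by symmetry, and the real part is the sum of the
    forms at [u] and [v]. *)
Lemma cpd_kernelP n A : (forall s t, A s t = A t s) ->
  cpd (\matrix_(s < n, t < n) (A s t)%:C) <-> cpd_kernel n A.
Proof.
move=> Asym; split=> [[_ H] c c0|H].
  have c0' : \sum_(s < n) (c s +i* 0) = 0 by rewrite sum_complex c0 big1.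
  have := H (fun s => (c s)%:C) c0'.
  have -> : \sum_s \sum_t (\matrix_(s < n, t < n) (A s t)%:C) s t *
      (c s)%:C^* * (c t)%:C = \sum_(s < n) \sum_(t < n) (A s t * c s * c t +i* 0).
    apply: eq_bigr => s _; apply: eq_bigr => t _; rewrite mxE.
    by apply/eqP; rewrite eq_complex /=; apply/andP; split; apply/eqP; ring.
  under eq_bigr do rewrite sum_complex.
  by rewrite sum_complex lecE /= => /andP[].
split.
  apply/is_hermitianmxP; rewrite expr0 scale1r; apply/matrixP => s t; rewrite !mxE.
  by rewrite Asym; apply/eqP; rewrite eq_complex /= oppr0 !eqxx.
move=> c c0.
(* [insub] extends functions on ['I_n] to [nat] by 0, as [kform] expects. *)
pose u s := if (insub s : option 'I_n) is Some i then complex.Re (c i) else 0.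
pose v s := if (insub s : option 'I_n) is Some i then complex.Im (c i) else 0.
have cE (s : 'I_n) : c s = u s +i* v s by rewrite /u /v valK; case: (c s).
have := c0; rewrite (eq_bigr _ (fun s _ => cE s)) sum_complex => -[u0 v0].
have -> : \sum_s \sum_t (\matrix_(s < n, t < n) (A s t)%:C) s t *
      (c s)^* * c t = \sum_(s < n) \sum_(t < n)
    ((A s t * u s * u t + A s t * v s * v t) +i*
     (A s t * u s * v t - A s t * v s * u t)).
  apply: eq_bigr => s _; apply: eq_bigr => t _; rewrite mxE !cE.
  by apply/eqP; rewrite eq_complex /=; apply/andP; split; apply/eqP; ring.
under eq_bigr do rewrite sum_complex.
rewrite sum_complex lecE /=; apply/andP; split.
  apply/eqP; under eq_bigr do rewrite sumrB.
  rewrite sumrB [X in _ - X]exchange_big /=; apply/eqP; rewrite subr_eq0; apply/eqP.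
  by apply: eq_bigr => s _; apply: eq_bigr => t _; rewrite Asym; ring.
under eq_bigr do rewrite big_split.
by rewrite big_split addr_ge0//; exact: H.
Qed.

End cpd_real.

(** * Conditional positivity of the logarithmic moment matrices *)

Section log_moments.
Context {R : realType} (a : weight_seq R).

Definition log_moment_kernel i s t : R := ln (moment a (i + s + t)).

Lemma log_moment_kernelC i s t :
  log_moment_kernel i s t = log_moment_kernel i t s.
Proof. by rewrite /log_moment_kernel addnAC. Qed.

Lemma cpd_log_momentsP :
  (forall i k : nat, (1 <= k)%N -> cpd (log_mx (moment_mx a i k))) <->
  (forall i n, cpd_kernel n (log_moment_kernel i)).
Proof.
have E i k : log_mx (moment_mx a i k) =
    \matrix_(s < k.+1, t < k.+1) (log_moment_kernel i s t)%:C.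
  by apply/matrixP => s t; rewrite !mxE.
split=> [H i n|H i k k1]; last by rewrite E; apply/cpd_kernelP => //; exact: log_moment_kernelC.
(* Since [k >= 1], the given matrices have size at least 2; every size [n] is reached from
   [n.+2]. *)
do 2!apply: cpd_kernel_le.
by apply/cpd_kernelP; [exact: log_moment_kernelC|rewrite -E; exact: H].
Qed.

Lemma icpd_log_momentsP i :
  icpd (log_imx (moment_imx a i)) <->
  (forall n, cpd_kernel n (log_moment_kernel i)).
Proof.
have E n (f : nat -> nat) :
    (\matrix_(s < n, t < n) log_imx (moment_imx a i) (f s) (f t)) =
    \matrix_(s < n, t < n) (log_moment_kernel i (f s) (f t))%:C.
  apply/matrixP => s t; rewrite !mxE /log_imx /moment_imx /log_moment_kernel.
  by rewrite addnC addnA.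
split=> [H n|H n f _].
  apply/cpd_kernelP; first exact: log_moment_kernelC.
  by rewrite -(E n id); apply: H.
pose g s := if (insub s : option 'I_n) is Some i then f i else 0%N.
have fE (s : 'I_n) : f s = g s by rewrite /g valK.
have -> : (\matrix_(s, t) log_imx (moment_imx a i) (f s) (f t)) =
    (\matrix_(s < n, t < n) log_imx (moment_imx a i) (g s) (g t)).
  by apply/matrixP => s t; rewrite !mxE !fE.
rewrite E; apply/(cpd_kernelP _ (A := fun s t => log_moment_kernel i (g s) (g t))).
  by move=> s t; exact: log_moment_kernelC.
exact: cpd_kernel_comp.
Qed.

(** The kernel for [i] is the pullback of the kernel for the parity of [i] under the shift of both
    indices by [i./2]. *)
Lemma cpd_log_moments01 :
  (forall n, cpd_kernel n (log_moment_kernel 0)) ->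
  (forall n, cpd_kernel n (log_moment_kernel 1)) ->
  forall i n, cpd_kernel n (log_moment_kernel i).
Proof.
move=> H0 H1 i n.
have : cpd_kernel n (fun s t => log_moment_kernel (odd i) (s + i./2) (t + i./2)).
  by apply: (@cpd_kernel_comp _ _ (addn^~ i./2)); case: (odd i).
suff -> : (fun s t => log_moment_kernel (odd i) (s + i./2) (t + i./2)) =
    log_moment_kernel i by [].
apply/funext => s; apply/funext => t; rewrite /log_moment_kernel.
by congr (ln (moment a _)); have := odd_double_half i; lia.
Qed.

End log_moments.

(** * Growth of log-convex sequences *)

Section logconvex.
Context {R : realType}.

(** Ratios of consecutive terms do not decrease, so a first ratio [r > W] would make [u n] at least
    [r ^+ n * u 0], beyond any multiple of [W ^+ n]. *)
Lemma logconvex_ratio_le (u : nat -> R) (C W : R) : 0 < W -> (forall n, 0 <= u n) ->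
  (forall n, u n.+1 ^+ 2 <= u n * u n.+2) -> (forall n, u n <= C * W ^+ n) ->
  u 1%N <= W * u 0%N.
Proof.
move=> W0 u0 ucvx uC; rewrite leNgt; apply/negP => u1.
have u1gt : 0 < u 1%N by rewrite (le_lt_trans _ u1)// mulr_ge0// ltW.
have u0gt : 0 < u 0%N.
  rewrite lt0r u0 andbT; apply/eqP => u00; have := ucvx 0%N.
  by rewrite u00 mul0r leNgt exprn_gt0.
pose r := u 1%N / u 0%N.
have r0 : 0 < r by rewrite divr_gt0.
have Wr : W < r by rewrite ltr_pdivlMr.
have step n : 0 < u n /\ r * u n <= u n.+1.
  elim: n => [|n [un run]]; first by split => //; rewrite divfK ?gt_eqF.
  have un1 : 0 < u n.+1 by rewrite (lt_le_trans _ run)// mulr_gt0.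
  split=> //; rewrite -(ler_pM2l un) (le_trans _ (ucvx n))//.
  by rewrite mulrCA mulrA expr2 ler_pM2r.
have ge n : r ^+ n * u 0%N <= u n.
  elim: n => [|n IH]; first by rewrite mul1r.
  by rewrite exprS -mulrA (le_trans _ (step n).2)// ler_pM2l.
(* Both bounds together give [u 0 <= C * (W / r) ^+ n], which tends to 0. *)
have : (fun n => C * (W / r) ^+ n) @ \oo --> C * 0.
  apply: cvgM; first exact: cvg_cst.
  apply: cvg_expr; rewrite ger0_norm ?divr_ge0 ?(ltW W0) ?(ltW r0)//.
  by rewrite ltr_pdivrMr ?mul1r.
rewrite mulr0 => H; have : u 0%N <= 0.
  apply: (cvgr_to_ge H); apply: nearW => n.
  rewrite expr_div_n mulrA ler_pdivlMr ?exprn_gt0// mulrC.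
  exact: le_trans (ge n) (uC n).
by rewrite leNgt u0gt.
Qed.

End logconvex.

(** * The Riesz functional of a moment sequence *)

Section moment_functional.
Context {R : realType} (m : nat -> R).
Implicit Types p q : {poly R}.

Definition mfun p : R := \sum_(i < size p) p`_i * m i.

Lemma mfun_widen p n : (size p <= n)%N -> mfun p = \sum_(i < n) p`_i * m i.
Proof.
move=> pn; rewrite /mfun (big_ord_widen n (fun i => p`_i * m i) pn).
rewrite big_mkcond; apply: eq_bigr => i _; case: ltnP => // pi.
by rewrite nth_default ?mul0r.
Qed.

Lemma mfun_linear : scalar mfun.
Proof.
move=> k p q; set n := maxn (size p) (size q).
rewrite (@mfun_widen (k *: p + q) n); last first.
  by rewrite (leq_trans (size_polyD _ _))// geq_max (leq_trans (size_scale_leq _ _))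
    ?leq_maxl ?leq_maxr.
rewrite (@mfun_widen p n) ?leq_maxl// (@mfun_widen q n) ?leq_maxr//.
rewrite mulr_sumr -big_split; apply: eq_bigr => i _ /=.
by rewrite coefD coefZ mulrDl mulrA.
Qed.

HB.instance Definition _ := GRing.isLinear.Build R {poly R} R *%R mfun mfun_linear.

Lemma mfunX n : mfun 'X^n = m n.
Proof.
rewrite /mfun size_polyXn big_ord_recr /= coefXn eqxx mul1r big1 ?add0r// => i _.
by rewrite coefXn ltn_eqF ?mul0r.
Qed.

Lemma poly_widen p n : (size p <= n)%N -> p = \sum_(i < n) p`_i *: 'X^i.
Proof.
move=> pn; rewrite -poly_def; apply/polyP => i; rewrite coef_poly; case: ltnP => // ni.
by rewrite nth_default// (leq_trans pn).
Qed.

Lemma mfun_sqr p n : (size p <= n)%N ->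
  mfun (p * p) = kform n (fun s t => m (s + t)) (fun i => p`_i).
Proof.
move=> pn; rewrite {1 2}(poly_widen pn) mulr_suml linear_sum; apply: eq_bigr => s _.
rewrite mulr_sumr linear_sum; apply: eq_bigr => t _ /=.
by rewrite -scalerAl -scalerAr -exprD !linearZ /= mfunX; ring.
Qed.

End moment_functional.

(** * Symmetrised moments *)

Section symmetrised_moments.
Context {R : realType} (g : nat -> R).

(** For [g] the moments of a measure on the half-line, these are the moments of the symmetric
    measure on the line that squaring maps to it. *)
Definition symm_moment (n : nat) : R := if odd n then 0 else g n./2.

Lemma sum_ord_double n (F : nat -> R) :
  \sum_(i < n.*2) F i = \sum_(i < n) F i.*2 + \sum_(i < n) F i.*2.+1.
Proof.
elim: n => [|n IH]; first by rewrite !big_ord0 addr0.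
by rewrite doubleS !big_ord_recr /= IH; ring.
Qed.

(** When [p] is split into even and odd parts, the cross terms meet only odd moments; the two
    remaining forms are the Hankel forms of [g] and of its shift. *)
Lemma mfun_symm_ge0 : (forall n, psd n (fun s t => g (s + t))) ->
  (forall n, psd n (fun s t => g (s + t).+1)) ->
  forall p, 0 <= mfun symm_moment (p * p).
Proof.
move=> g0 g1 p; have pn : (size p <= (size p).*2)%N by rewrite -addnn leq_addr.
rewrite (mfun_sqr _ pn); set n := size p.
suff -> : kform n.*2 (fun s t => symm_moment (s + t)) (fun i => p`_i) =
   kform n (fun s t => g (s + t)) (fun i => p`_i.*2) +
   kform n (fun s t => g (s + t).+1) (fun i => p`_i.*2.+1).
  by rewrite addr_ge0 ?g0 ?g1.
rewrite /kform (sum_ord_double _ (fun s => \sum_(t < n.*2)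
  symm_moment (s + t) * p`_s * p`_t)); congr (_ + _); apply: eq_bigr => s _.
  rewrite (sum_ord_double _ (fun t => symm_moment (s.*2 + t) * p`_s.*2 * p`_t)).
  rewrite [X in _ + X]big1 ?addr0 => [|t _].
    by apply: eq_bigr => t _; rewrite /symm_moment -doubleD odd_double doubleK.
  by rewrite /symm_moment addnS -doubleD /= odd_double !mul0r.
rewrite (sum_ord_double _ (fun t => symm_moment (s.*2.+1 + t) * p`_s.*2.+1 * p`_t)).
rewrite [X in X + _]big1 ?add0r => [|t _].
  apply: eq_bigr => t _; rewrite /symm_moment addnS addSn -doubleD -doubleS.
  by rewrite odd_double doubleK.
by rewrite /symm_moment addSn -doubleD /= odd_double !mul0r.
Qed.

End symmetrised_moments.

(** * Orthogonal polynomials of a symmetric, possibly degenerate, functional *)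

Section orthogonal_polynomials.
Context {R : realType} (m : nat -> R) (W : R).
Hypothesis W_gt0 : 0 < W.
Hypothesis m_odd : forall n, odd n -> m n = 0.
Hypothesis m_bound : forall n, `|m n| <= W ^+ n.
Hypothesis m_pos : forall p, 0 <= mfun m (p * p).
Local Notation L := (mfun m).
Implicit Types p q : {poly R}.

Lemma mfun_CauchySchwarz p q : L (p * q) ^+ 2 <= L (p * p) * L (q * q).
Proof.
apply: quadratic_discr => // x; have := m_pos (q + x *: p).
congr (0 <= _).
rewrite mulrDl !mulrDr -!scalerAl -!scalerAr (mulrC q p) !linearD !linearZ /=.
by rewrite /GRing.scale /=; ring.
Qed.

(** Cauchy-Schwarz makes a null polynomial orthogonal to everything; this handles degenerate
    functionals. *)
Lemma mfun_null p q : L (p * p) = 0 -> L (p * q) = 0.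
Proof.
move=> p0; apply/eqP; rewrite -sqrf_eq0 eq_le sqr_ge0 andbT.
by rewrite (le_trans (mfun_CauchySchwarz p q))// p0 mul0r.
Qed.

(** Along the powers of ['X] the squared seminorms [u n] are log-convex by Cauchy-Schwarz and at
    most [C * (W ^+ 2) ^+ n], so [logconvex_ratio_le] bounds the first ratio. *)
Lemma mfun_mulX_le p : L ('X * p * ('X * p)) <= W ^+ 2 * L (p * p).
Proof.
pose u n := L (('X^n * p) * ('X^n * p)).
pose C := \sum_(j < size (p * p)) `|(p * p)`_j| * W ^+ j.
have := @logconvex_ratio_le R u C (W ^+ 2).
rewrite /u expr0 expr1 mul1r; apply; first by rewrite exprn_gt0.
- by move=> n; exact: m_pos.
- move=> n; have -> : 'X^(n.+1) * p * ('X^(n.+1) * p) = ('X^n * p) * ('X^(n.+2) * p).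
    by rewrite !exprS; ring.
  exact: mfun_CauchySchwarz.
- move=> n; have -> : 'X^n * p * ('X^n * p) = 'X^(n.*2) * (p * p).
    by rewrite -addnn exprD; ring.
  rewrite (poly_widen (leqnn (size (p * p)))) mulr_sumr linear_sum mulr_suml.
  apply: ler_sum => j _; rewrite -scalerAr -exprD linearZ /= mfunX.
  apply: (le_trans (ler_norm _)); rewrite normrM -mulrA ler_wpM2l//.
  by rewrite (le_trans (m_bound _))// exprD -muln2 mulnC exprM mulrC.
Qed.

(** Monic orthogonal polynomials by the three-term recurrence, two consecutive ones at a time.
    Symmetry of [m] leaves no middle term, and the quotient is 0 if [L (p * p) = 0]. *)
Fixpoint op_pair n : {poly R} * {poly R} :=
  if n is k.+1 then let: (p, q) := op_pair k in
    (q, 'X * q - (L (q * q) / L (p * p)) *: p) else (1, 'X).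

Definition op n := (op_pair n).1.
Definition op_sqnorm n := L (op n * op n).
Definition op_coef n := op_sqnorm n.+1 / op_sqnorm n.

Lemma opSS n : op n.+2 = 'X * op n.+1 - op_coef n *: op n.
Proof. by rewrite /op_coef /op_sqnorm /op /=; case: (op_pair n). Qed.

Lemma mulX_op n :
  'X * op n = op n.+1 + (if n is k.+1 then op_coef k *: op k else 0).
Proof. by case: n => [|n]; rewrite ?opSS ?subrK// addr0 mulr1. Qed.

Lemma op_parity n i : odd (n + i) -> (op n)`_i = 0.
Proof.
(* Two consecutive degrees are proved together, as the recurrence requires. *)
suff H : (forall i, odd (n + i) -> (op n)`_i = 0) /\
         (forall i, odd (n.+1 + i) -> (op n.+1)`_i = 0) by apply H.
elim: n {i} => [|n [IH1 IH2]].
  by split=> -[|[|i]] //; rewrite ?coef1 ?coefX.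
split=> // i ni; rewrite opSS coefB coefXM coefZ.
rewrite IH1 ?mulr0 ?subr0; last by move: ni; rewrite !addSn /= negbK.
by case: i ni => [|i] //= ni; apply: IH2; move: ni; rewrite !addSn !addnS /= !negbK.
Qed.

(** The product of two consecutive polynomials is odd, so only odd moments occur. *)
Lemma mfun_op_succ n : L (op n.+1 * op n) = 0.
Proof.
rewrite /mfun big1// => i _; have [io|ie] := boolP (odd i); first by rewrite m_odd ?mulr0.
rewrite coefM big1 ?mul0r// => -[j /=]; rewrite ltnS => ji _.
have [no|ne] := boolP (odd (n + j)); last by rewrite op_parity ?mul0r// addSn /= ne.
rewrite [X in _ * X]op_parity ?mulr0//; move: no ie; rewrite -{1}(subnK ji) !oddD.
by case: odd; case: odd; case: odd.
Qed.

(** In [L (op n.+2 * op i)] the factor ['X] moves onto [op i]; orthogonality in lower degree kills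
    all terms but those for [i = n], which cancel by the choice of [op_coef n]. *)
Lemma op_orthogonal n i : (i < n)%N -> L (op n * op i) = 0.
Proof.
clear W W_gt0 m_bound.
have [k] := ubnP n; elim: k n i => // k IH n i.
case: n => [//|[|n]] nk ni; first by case: i ni => // _; exact: mfun_op_succ.
have [->|in1] := eqVneq i n.+1; first exact: mfun_op_succ.
have {ni in1} ni : (i <= n)%N by lia.
have nk' : (n.+1 < k)%N by [].
have orth j l : (j <= n.+1)%N -> (l < j)%N -> L (op j * op l) = 0.
  by move=> jn; apply: IH; exact: leq_ltn_trans jn nk'.
(* A zero norm propagates upwards, so the quotient by zero in [op_coef] does no harm. *)
have sqnorm0 : op_sqnorm n = 0 -> op_sqnorm n.+1 = 0.
  move=> h0; rewrite /op_sqnorm.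
  have E : op n.+1 = 'X * op n - (if n is k.+1 then op_coef k *: op k else 0).
    by rewrite mulX_op addrK.
  rewrite {2}E mulrBr linearB /= mulrCA mulrA [_ * op n]mulrC mfun_null//.
  rewrite sub0r; case: (n) nk' orth {h0 E} => [|l] nk' orth.
    by rewrite mulr0 linear0 oppr0.
  by rewrite -scalerAr linearZ /= orth ?mulr0 ?oppr0.
have -> : op n.+2 * op i = op n.+1 * ('X * op i) - op_coef n *: (op n * op i).
  by rewrite opSS mulrBl -scalerAl [X in X - _]mulrAC [X in X - _]mulrC mulrA.
rewrite linearB linearZ /= mulX_op mulrDr linearD /=.
have -> : L (op n.+1 * (if i is l.+1 then op_coef l *: op l else 0)) = 0.
  case: (i) ni => [|l] ni; first by rewrite mulr0 linear0.
  by rewrite -scalerAr linearZ /= orth ?mulr0//; lia.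
rewrite addr0; have [->|in1] := eqVneq i n.
  rewrite -/(op_sqnorm n.+1) -/(op_sqnorm n) /op_coef.
  have [h0|h0] := eqVneq (op_sqnorm n) 0; first by rewrite sqnorm0// h0 mulr0 subrr.
  by rewrite divfK ?subrr.
by rewrite !orth ?mulr0 ?subrr//; lia.
Qed.

Lemma mfun_opM i j : L (op i * op j) = if i == j then op_sqnorm i else 0.
Proof.
case: ltngtP => [ij|ji|->//]; last exact: op_orthogonal.
by rewrite mulrC op_orthogonal.
Qed.

Lemma op_sqnormS n : op_sqnorm n.+1 = L (op n.+1 * ('X * op n)).
Proof.
rewrite mulX_op mulrDr linearD /= -/(op_sqnorm n.+1).
case: n => [|n]; first by rewrite mulr0 linear0 addr0.
by rewrite -scalerAr linearZ /= op_orthogonal ?mulr0 ?addr0.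
Qed.

(** [op n.+1] is the component of ['X * op n] orthogonal to lower degrees, hence no longer than it,
    and multiplication by ['X] is bounded by [W]. *)
Lemma op_sqnorm_le n : op_sqnorm n.+1 <= W ^+ 2 * op_sqnorm n.
Proof.
apply: le_trans (mfun_mulX_le (op n)).
have h0 : 0 <= op_sqnorm n.+1 by exact: m_pos.
have := mfun_CauchySchwarz (op n.+1) ('X * op n).
rewrite -op_sqnormS -/(op_sqnorm n.+1) expr2.
have [->|h1] := eqVneq (op_sqnorm n.+1) 0; first by rewrite m_pos.
by rewrite ler_pM2l// lt0r h1.
Qed.

(** When [op_sqnorm n = 0] the quotient cannot be cancelled, but [op n] is then null and
    [op_sqnorm n.+1] vanishes as well. *)
Lemma op_coef_sqnorm n : op_coef n * op_sqnorm n = op_sqnorm n.+1.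
Proof.
rewrite /op_coef; have [h0|h0] := eqVneq (op_sqnorm n) 0; last by rewrite divfK.
rewrite h0 mulr0 op_sqnormS.
have -> : op n.+1 * ('X * op n) = op n * ('X * op n.+1) by ring.
by rewrite mfun_null.
Qed.

Lemma op_coef_ge0 n : 0 <= op_coef n.
Proof. by rewrite divr_ge0 ?m_pos. Qed.

Lemma op_coef_le n : op_coef n <= W ^+ 2.
Proof.
have [h0|h0] := eqVneq (op_sqnorm n) 0.
  by rewrite /op_coef h0 invr0 mulr0 exprn_ge0// ltW.
by rewrite ler_pdivrMr ?op_sqnorm_le// lt0r h0 m_pos.
Qed.

(** Coordinates of ['X^d] in the orthogonal polynomials; the recursion is multiplication by ['X]
    read through [mulX_op]. *)
Fixpoint op_expand d j : R :=
  if d is e.+1 then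
    (if j is k.+1 then op_expand e k else 0) + op_coef j * op_expand e j.+1
  else (j == 0%N)%:R.

Lemma op_expand_gt d j : (d < j)%N -> op_expand d j = 0.
Proof.
elim: d j => [|d IH] [|j]//= dj.
by rewrite !IH ?mulr0 ?addr0// ltnW// ltnW.
Qed.

Lemma op_expandE d : 'X^d = \sum_(j < d.+1) op_expand d j *: op j.
Proof.
elim: d => [|d IH]; first by rewrite big_ord_recl big_ord0 /= addr0 scale1r expr0.
rewrite exprS {}IH mulr_sumr.
under eq_bigr do rewrite -scalerAr mulX_op scalerDr.
rewrite big_split /=.
under [RHS]eq_bigr do rewrite scalerDl.
rewrite [RHS]big_split /=; congr (_ + _).
  by rewrite [RHS]big_ord_recl /= scale0r add0r.
rewrite big_ord_recl /= scaler0 add0r.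
rewrite [RHS]big_ord_recr /= (op_expand_gt (j := d.+2))// mulr0 scale0r addr0.
rewrite [RHS]big_ord_recr /= (op_expand_gt (j := d.+1))// mulr0 scale0r addr0.
by apply: eq_bigr => j _; rewrite /bump /= add1n scalerA mulrC.
Qed.

(** Parseval's identity for ['X^d]. *)
Lemma op_expand_sqr d :
  \sum_(j < d.+1) op_expand d j ^+ 2 * op_sqnorm j = m (d.*2).
Proof.
rewrite -mfunX -addnn exprD op_expandE mulr_suml linear_sum; apply: eq_bigr => i _.
rewrite /= [X in _ = mfun m X]mulr_sumr linear_sum (bigD1 i)//= [X in _ + X]big1 ?addr0.
  set e := op_expand d i; have -> : e *: op i * (e *: op i) = e ^+ 2 *: (op i * op i).
    by rewrite -scalerAl -scalerAr scalerA expr2.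
  by rewrite linearZ.
move=> j ji; rewrite -scalerAl -scalerAr scalerA linearZ /= mfun_opM.
have /negbTE -> : (i != j :> nat) by rewrite eq_sym.
by rewrite mulr0.
Qed.

End orthogonal_polynomials.

(** * The bounded Jacobi matrix *)

Section jacobi.
Context {R : realType}.

Definition jacobi_step (b : nat -> R) (y : nat -> R) j : R :=
  (if j is k.+1 then b k * y k else 0) + b j * y j.+1.

(* [y d] is [J^d e_0] for the Jacobi matrix [J] of the symmetrised moment
   functional, which has zero diagonal and off-diagonal entries [b]. *)
Lemma jacobi_of_moments (g : nat -> R) (W : R) : 0 < W ->
  (forall n, 0 <= g n <= W ^+ n.*2) ->
  (forall n, psd n (fun s t => g (s + t))) ->
  (forall n, psd n (fun s t => g (s + t).+1)) ->
  exists (b : nat -> R) (y : nat -> nat -> R),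
    [/\ forall j, 0 <= b j <= W,
        forall d j, y d.+1 j = jacobi_step b (y d) j,
        forall d j, (d < j)%N -> y d j = 0
      & forall d, \sum_(j < d.+1) y d j ^+ 2 = g d].
Proof.
move=> W0 gW g0 g1; pose m := symm_moment g.
have m_odd n : odd n -> m n = 0 by rewrite /m /symm_moment => ->.
have m_bound n : `|m n| <= W ^+ n.
  rewrite /m /symm_moment; case: ifPn => no.
    by rewrite normr0 exprn_ge0// ltW.
  by have /andP[gn gWn] := gW n./2; rewrite ger0_norm// (le_trans gWn)// even_halfK.
have m_pos := mfun_symm_ge0 g0 g1.
have h_ge0 j : 0 <= op_sqnorm m j by exact: m_pos.
have l_ge0 j : 0 <= op_coef m j by exact: op_coef_ge0.
have hS j : Num.sqrt (op_coef m j) * Num.sqrt (op_sqnorm m j) =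
    Num.sqrt (op_sqnorm m j.+1).
  by rewrite -sqrtrM// (op_coef_sqnorm m_odd m_pos).
(* Normalising the polynomials makes the recurrence symmetric, with these off-diagonal entries, and
   multiplies each coordinate by the norm of [op j]. *)
exists (fun j => Num.sqrt (op_coef m j)).
exists (fun d j => op_expand m d j * Num.sqrt (op_sqnorm m j)); split=> [j|d j|d j dj|d].
- rewrite sqrtr_ge0 -(ger0_norm (ltW W0)) -sqrtr_sqr ler_wsqrtr//.
  exact: (op_coef_le W0 m_odd m_bound m_pos).
- rewrite /jacobi_step -hS /= mulrDl; congr (_ + _).
    by case: j => [|j]; rewrite ?mul0r// -hS; ring.
  rewrite -{1}(sqr_sqrtr (l_ge0 j)); ring.
- by rewrite op_expand_gt ?mul0r.
- transitivity (m d.*2); last by rewrite /m /symm_moment odd_double doubleK.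
  rewrite -(op_expand_sqr m_odd m_pos); apply: eq_bigr => j _.
  by rewrite exprMn sqr_sqrtr.
Qed.

End jacobi.

(** * Isometries of Hilbert spaces *)

Section isometries.
Context {R : realType}.
Local Notation C := R[i].

(** Polarisation: the norm identity is expanded at [x + c *: y], then [c] is taken to be 1 and
    ['i]. *)
Lemma inner_of_norm (H K : hilbertType R) (f : {linear H -> K}) :
  (forall x, inner (f x) (f x) = inner x x) ->
  forall x y, inner (f x) (f y) = inner x y.
Proof.
move=> fx x y.
have E (c : C) : c^* * (inner (f x) (f y) - inner x y) +
    c * (inner (f y) (f x) - inner y x) = 0.
  have := fx (x + c *: y); rewrite linearD linearZ /= !linearDl !linearDr /=.
  rewrite !linearZl_LR !linearZr_LR /= !fx => /eqP; rewrite -subr_eq0 => /eqP h.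
  by rewrite -[RHS]h; ring.
have := E 1; have := E 'i; rewrite conjC1 conjCi !mul1r mulNr addrC -mulrBr.
move=> /eqP; rewrite mulf_eq0 (negbTE (neq0Ci _)) /= subr_eq0 => /eqP -> /eqP.
by rewrite -mulr2n mulrn_eq0 /= subr_eq0 => /eqP.
Qed.

Lemma isometry_norm (H K : hilbertType R) (f : {linear H -> K}) :
  (forall x y, inner (f x) (f y) = inner x y) -> forall x, `|f x| = `|x|.
Proof.
move=> fi x; apply/eqP; rewrite -(@eqrXn2 _ 2)// -!inner_norm; exact/eqP/fi.
Qed.

(** The neighbourhoods of a closure point pull back to a Cauchy filter, whose limit in the complete
    space [H] is a preimage. *)
Lemma isometry_closed (H K : hilbertType R) (f : {linear H -> K}) :
  (forall x y, inner (f x) (f y) = inner x y) -> closed (range f).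
Proof.
move=> fi z zcl.
have fB x y : `|f x - f y| = `|x - y| by rewrite -linearB isometry_norm.
pose F : set_system H := filter_from (nbhs z) (fun B => f @^-1` B).
have FF : ProperFilter F.
  apply: filter_from_proper => [|B zB]; last first.
    by have [_ [[x _ <-] Bx]] := zcl _ zB; exists x.
  apply: filter_from_filter => [|B D zB zD]; first by exists setT; exact: filterT.
  by exists (B `&` D); [exact: filterI|].
have Fc : cauchy F.
  apply: cauchy_exP => e e0; have e20 : 0 < e / 2 by rewrite divr_gt0.
  have [_ [[x _ <-] zx]] := zcl _ (nbhsx_ballx z (e / 2) e20).
  exists x; exists (ball z (e / 2)); first exact: nbhsx_ballx.
  move=> y zy; rewrite -ball_normE /= -fB [e]splitr.
  rewrite (le_lt_trans (ler_distD z _ _))// ltrD//; last by move: zy; rewrite -ball_normE.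
  by move: zx; rewrite -ball_normE /= distrC.
have /(cvg_ex F)[x Fx] : cvg F by exact: cauchy_cvg.
(* Otherwise some [y] near [x] with [f y] near [z], both within half the distance from [f x] to [z],
   contradicts the triangle inequality. *)
exists x => //; apply/eqP; rewrite -subr_eq0 -normr_le0; apply/negPn/negP => e0.
have {}e0 : 0 < `|f x - z| by rewrite normr_gt0 -normr_le0.
have e20 : 0 < `|f x - z| / 2 by rewrite divr_gt0.
have F1 : F (ball x (`|f x - z| / 2)) by apply: Fx; exact: nbhsx_ballx.
have F2 : F (f @^-1` ball z (`|f x - z| / 2)).
  by exists (ball z (`|f x - z| / 2)) => //; exact: nbhsx_ballx.
have [y [/= xy zy]] := filter_ex (filterI F1 F2).
suff : `|f x - z| < `|f x - z| by rewrite ltxx.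
rewrite [ltRHS]splitr (le_lt_trans (ler_distD (f y) _ _))// ltrD//.
  by rewrite fB; move: xy; rewrite -ball_normE.
by rewrite distrC; move: zy; rewrite -ball_normE.
Qed.

End isometries.

(** * Permutation and multiplication operators on [ell2] *)

Section ell2_esum.
Context {R : realType}.
Local Notation C := R[i].

(** An unordered sum in the extended reals can be reindexed and iterated before convergence is
    known. *)
Definition ell2_sum (x : nat -> C) : \bar R :=
  (\esum_(n in [set: nat]) (Normc.normc (x n) ^+ 2)%:E)%E.

Lemma ell2_sum_lim (x : nat -> C) : square_summable x ->
  ell2_sum x = (limn (series (fun n => Normc.normc (x n) ^+ 2)))%:E.
Proof.
move=> xs; rewrite /ell2_sum -nneseries_esumT => [|n]; last by rewrite lee_fin sqr_ge0.
rewrite -EFin_lim//; apply/congr_lim/funext => n.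
by rewrite /= /series /= sumEFin.
Qed.

Lemma ell2_sum_fin (x : nat -> C) : (ell2_sum x < +oo)%E -> x \in @ell2_pred R.
Proof.
have x0 : (0 <= ell2_sum x)%E by apply: esum_ge0 => n _; rewrite lee_fin sqr_ge0.
move=> xoo; apply/asboolP/(@square_summable_ub _ _ (fine (ell2_sum x))) => N.
rewrite -lee_fin fineK ?ge0_fin_numE// /ell2_sum -nneseries_esumT => [|n]; last first.
  by rewrite lee_fin sqr_ge0.
rewrite /series /= -sumEFin; apply: nneseries_lim_ge => n _ _.
by rewrite lee_fin sqr_ge0.
Qed.

Lemma ell2_inner_sum (x : ell2 R) : (inner x x) = (fine (ell2_sum x))%:C.
Proof. by rewrite ell2_sum_lim ?[LHS]ell2_inner_norm//; exact: ell2P. Qed.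

Lemma ell2_sum_lty (x : ell2 R) : (ell2_sum x < +oo)%E.
Proof. by rewrite ell2_sum_lim ?ltry//; exact: ell2P. Qed.

Section permutation.
Variables (s : nat -> nat) (bs : bijective s).

Lemma ell2_sum_perm (x : nat -> C) : ell2_sum (x \o s) = ell2_sum x.
Proof.
symmetry; apply: (@reindex_esum _ _ _ setT setT s).
by rewrite setTT_bijective.
Qed.

Lemma ell2_perm_subproof (x : ell2 R) : (x : nat -> C) \o s \in @ell2_pred R.
Proof. by apply: ell2_sum_fin; rewrite ell2_sum_perm ell2_sum_lty. Qed.

Definition ell2_perm (x : ell2 R) : ell2 R := Ell2 (ell2_perm_subproof x).

Lemma ell2_perm_linear : linear ell2_perm.
Proof. by move=> c x y; apply/val_inj. Qed.

HB.instance Definition _ :=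
  GRing.isLinear.Build C (ell2 R) (ell2 R) *:%R ell2_perm ell2_perm_linear.

Lemma ell2_perm_inner x y : inner (ell2_perm x) (ell2_perm y) = inner x y.
Proof.
move: x y; apply: inner_of_norm => x.
by rewrite !ell2_inner_sum /= ell2_sum_perm.
Qed.

End permutation.

Section multiplication.
Variables (w : nat -> R) (W : R) (wW : forall n, 0 <= w n <= W).

Lemma normc_mul_le n (z : C) :
  Normc.normc ((w n)%:C * z) ^+ 2 <= W ^+ 2 * Normc.normc z ^+ 2.
Proof.
have /andP[w0 w1] := wW n.
rewrite Normc.normcM exprMn ler_wpM2r ?sqr_ge0//.
by rewrite sqr_normcE /= expr0n addr0 ler_pXn2r ?nnegrE// (le_trans w0).
Qed.

Lemma ell2_mul_subproof (x : ell2 R) : (fun n => (w n)%:C * x n) \in @ell2_pred R.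
Proof.
apply/asboolP; have cx := is_cvg_series_mul (k := W ^+ 2) (@ell2P R x).
apply: series_le_cvg cx => n; first exact: sqr_ge0.
  by apply: mulr_ge0; exact: sqr_ge0.
exact: normc_mul_le.
Qed.

Definition ell2_mul (x : ell2 R) : ell2 R := Ell2 (ell2_mul_subproof x).

Lemma ell2_mul_linear : linear ell2_mul.
Proof.
move=> c x y; apply/val_inj/funext => n.
by rewrite -[LHS]/((w n)%:C * (c * x n + y n)) mulrDr mulrCA.
Qed.

HB.instance Definition _ :=
  GRing.isLinear.Build C (ell2 R) (ell2 R) *:%R ell2_mul ell2_mul_linear.

Lemma ell2_mul_inner x y : inner (ell2_mul x) y = inner x (ell2_mul y).
Proof.
rewrite -[LHS]/(csum _) -[RHS]/(csum _); congr csum; apply/funext => n.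
rewrite /= rmorphM /= mulrCA mulrA; congr (_ * _ * _).
by apply/eqP; rewrite eq_complex /= oppr0 !eqxx.
Qed.

Lemma ell2_mul_norm x : `|ell2_mul x| <= W%:C * `|x|.
Proof.
have W0 : 0 <= W by have /andP[w0] := wW 0%N; apply: le_trans.
rewrite -(@ler_pXn2r _ 2) ?nnegrE ?mulr_ge0 ?lecR// exprMn -!inner_norm.
rewrite !ell2_inner_sum -rmorphXn -rmorphM lecR !ell2_sum_lim; [|exact: ell2P..].
apply: limr_le; first exact: (@ell2P R (ell2_mul x)).
apply: nearW => N /=; apply: le_trans (ler_wpM2l (sqr_ge0 _) (ell2_partial_le x N)).
rewrite /series /= mulr_sumr; apply: ler_sum => n _; exact: normc_mul_le.
Qed.

End multiplication.

End ell2_esum.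

(** * The normal extension on the grid *)

Section normal_extension.
Context {R : realType}.
Local Notation C := R[i].
Variables (enc : int * int -> nat) (dec : nat -> int * int).
Hypotheses (decK : cancel dec enc) (encK : cancel enc dec).
Variables (b : nat -> R) (W : R).
Hypothesis bW : forall j, 0 <= b j <= W.

(* [dec] makes [ell2] a copy of l^2(Z x Z); both indices range over Z, with [b]
   extended by 0 to negative indices, so that the grid shifts are bijective and
   act unitarily. *)
Definition grid_shift (u v : int) n := enc ((dec n).1 + u, (dec n).2 + v).

Lemma grid_shiftK u v : cancel (grid_shift u v) (grid_shift (- u) (- v)).
Proof. by move=> n; rewrite /grid_shift encK /= !addrK -surjective_pairing decK. Qed.

Lemma grid_shift_bij u v : bijective (grid_shift u v).
Proof.
exists (grid_shift (- u) (- v)); first exact: grid_shiftK.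
by move=> n; have := grid_shiftK (- u) (- v) n; rewrite !opprK.
Qed.

Definition zcoef (j : int) : R := if j is Posz k then b k else 0.

(** The Jacobi entries feeding the second index [j]: from [j - 1] in [up_weight], from [j + 1] in
    [down_weight]. *)
Definition up_weight n := zcoef ((dec n).2 - 1).
Definition down_weight n := zcoef (dec n).2.

Lemma zcoef_bound j : 0 <= zcoef j <= W.
Proof.
case: j => [k|k]; first exact: bW.
by rewrite lexx /=; have /andP[b0] := bW 0; apply: le_trans.
Qed.

Definition up_bound n : 0 <= up_weight n <= W := zcoef_bound _.
Definition down_bound n : 0 <= down_weight n <= W := zcoef_bound _.

Let Mu : {linear ell2 R -> ell2 R} := ell2_mul up_bound.
Let Md : {linear ell2 R -> ell2 R} := ell2_mul down_bound.
Let P u v : {linear ell2 R -> ell2 R} := ell2_perm (grid_shift_bij u v).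

(** The bilateral shift of the first index tensored with the Jacobi matrix in the second. *)
Definition jacobi_shift : {linear ell2 R -> ell2 R} :=
  (Mu \o P (-1) (-1)) \+ (Md \o P (-1) 1).
Definition jacobi_shift_adj : {linear ell2 R -> ell2 R} :=
  (P 1 1 \o Mu) \+ (P 1 (-1) \o Md).

Lemma perm_norm u v x : `|P u v x| = `|x|.
Proof. by apply: isometry_norm; exact: ell2_perm_inner. Qed.

Lemma perm_adj u v x y : inner (P u v x) y = inner x (P (- u) (- v) y).
Proof.
have {1}-> : y = P u v (P (- u) (- v) y).
  by apply/val_inj/funext => n /=; rewrite grid_shiftK.
exact: ell2_perm_inner.
Qed.

Lemma jacobi_shiftE x n : jacobi_shift x n =
  (up_weight n)%:C * x (grid_shift (-1) (-1) n) +
  (down_weight n)%:C * x (grid_shift (-1) 1 n).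
Proof. by []. Qed.

Lemma jacobi_shift_adjE x n : jacobi_shift_adj x n =
  (up_weight (grid_shift 1 1 n))%:C * x (grid_shift 1 1 n) +
  (down_weight (grid_shift 1 (-1) n))%:C * x (grid_shift 1 (-1) n).
Proof. by []. Qed.

(** Multiplications by real weights are self-adjoint, and grid shifts are unitary with the opposite
    shift as inverse. *)
Lemma jacobi_shift_adjP : adjoint_of jacobi_shift jacobi_shift_adj.
Proof.
move=> x y; rewrite /= linearDl linearDr /=; congr (_ + _).
  by rewrite [LHS]ell2_mul_inner [LHS]perm_adj !opprK.
by rewrite [LHS]ell2_mul_inner [LHS]perm_adj !opprK.
Qed.

(** The shifts of the first index cancel in either order, so both composites act as the square of
    the Jacobi matrix in the second index. *)
Lemma jacobi_shiftC x : jacobi_shift (jacobi_shift_adj x) = jacobi_shift_adj (jacobi_shift x).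
Proof.
apply/val_inj/funext => n.
rewrite -[LHS]/(jacobi_shift (jacobi_shift_adj x) n).
rewrite -[RHS]/(jacobi_shift_adj (jacobi_shift x) n).
rewrite jacobi_shiftE !jacobi_shift_adjE !jacobi_shiftE.
rewrite /up_weight /down_weight /grid_shift !encK /=.
case: (dec n) => d j /=.
by rewrite !addrK ?subrK; ring.
Qed.

Lemma jacobi_shift_normal : normal_operator jacobi_shift.
Proof.
split.
  exists (W%:C + W%:C) => x; rewrite mulrDl (le_trans (ler_normD _ _))// lerD//.
    by rewrite (le_trans (ell2_mul_norm _ _))// perm_norm.
  by rewrite (le_trans (ell2_mul_norm _ _))// perm_norm.
exists jacobi_shift_adj; split; first exact: jacobi_shift_adjP.
exact: jacobi_shiftC.
Qed.

(** [beta e] stands for the unit vector along [J^e e_0]; [betaS] says that [J] maps it to [a e]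
    times the next one. *)
Variables (beta : nat -> nat -> R) (a : weight_seq R).
Hypothesis betaS : forall e k, beta e.+1 k * a e = jacobi_step b (beta e) k.
Hypothesis beta_gt : forall e k, (e < k)%N -> beta e k = 0.
Hypothesis beta1 : forall e, \sum_(k < e.+1) beta e k ^+ 2 = 1.

(** Basis vector [e] goes to [beta e] placed at first index [e]; distinct first indices give
    orthogonal images. *)
Definition grid_embed_fun (x : nat -> C) n : C :=
  if dec n is (Posz e, Posz k) then (beta e k)%:C * x e else 0.

(** After reindexing by [dec] and dropping negative indices, summing over [k] first leaves
    [|x e|^2], as [beta e] is a unit vector. *)
Lemma grid_embed_sum x : ell2_sum (grid_embed_fun x) = ell2_sum x.
Proof.
pose F (p : int * int) : \bar R := (if p is (Posz e, Posz k) then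
   (beta e k ^+ 2 * Normc.normc (x e) ^+ 2)%:E else 0)%E.
have F0 p : (0 <= F p)%E.
  case: p => -[e|e] [k|k] //; rewrite /F lee_fin.
  by apply: mulr_ge0; exact: sqr_ge0.
have -> : ell2_sum (grid_embed_fun x) = (\esum_(n in [set: nat]) F (dec n))%E.
  apply: eq_esum => n _; rewrite /grid_embed_fun /F.
  case: (dec n) => -[e|e] [k|k]; try by rewrite Normc.normc0 expr0n.
  by rewrite Normc.normcM exprMn [X in X * _]sqr_normcE /= expr0n addr0.
rewrite -(@reindex_esum _ _ _ setT setT dec F); last first.
  by rewrite setTT_bijective; exists enc.
pose emb (q : nat * nat) : int * int := (Posz q.1, Posz q.2).
have -> : (\esum_(p in [set: int * int]) F p = \esum_(p in range emb) F p)%E.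
  rewrite [RHS]esum_mkcond; apply: eq_esum => -[[e|e] [k|k]] _; case: ifPn => //.
  by move/negP; rewrite inE; case; exists (e, k).
rewrite esum_image; last by move=> [e k] [e' k'] _ _ [-> ->].
transitivity (\esum_(e in [set: nat]) \esum_(k in [set: nat]) F (emb (e, k)))%E.
  rewrite (@esum_esum _ _ _ setT (fun=> setT) (fun e k => F (emb (e, k))))//.
  apply: (congr2 (fun A G => esum A G)); last by apply/funext => -[].
  by apply/seteqP; split.
apply: eq_esum => e _; rewrite -nneseries_esumT// /F /=.
rewrite (@nneseries_split _ _ 0 e.+1) => [|k _]; last exact: (F0 (emb (e, k))).
rewrite eseries0 ?adde0; last first.
  by move=> k ek _; rewrite beta_gt ?expr0n ?mul0r//.
rewrite add0n big_mkord sumEFin; congr EFin.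
by rewrite -mulr_suml beta1 mul1r.
Qed.

Lemma grid_embed_subproof (x : ell2 R) : grid_embed_fun x \in @ell2_pred R.
Proof. by apply: ell2_sum_fin; rewrite grid_embed_sum ell2_sum_lty. Qed.

Definition grid_embed (x : ell2 R) : ell2 R := Ell2 (grid_embed_subproof x).

Lemma grid_embed_linear : linear grid_embed.
Proof.
move=> c x y; apply/val_inj/funext => n.
rewrite -[RHS]/(c * grid_embed_fun x n + grid_embed_fun y n).
rewrite -[LHS]/(grid_embed_fun (fun n => c * x n + y n) n) /grid_embed_fun.
by case: (dec n) => -[e|e] [k|k]; rewrite ?mulr0 ?addr0// mulrDr mulrCA.
Qed.

HB.instance Definition _ :=
  GRing.isLinear.Build C (ell2 R) (ell2 R) *:%R grid_embed grid_embed_linear.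

Lemma grid_embed_shift x : grid_embed (wshift a x) = jacobi_shift (grid_embed x).
Proof.
apply/val_inj/funext => n.
rewrite -[RHS]/(jacobi_shift (grid_embed x) n) jacobi_shiftE.
rewrite -[LHS]/(grid_embed_fun (wshift_fun a x) n).
rewrite /= /grid_embed_fun /grid_shift !encK /up_weight /down_weight.
case: (dec n) => d j /=.
have S (e : nat) : Posz e.+1 - 1 = Posz e by lia.
have T (e : nat) : Posz e + 1 = Posz e.+1 by lia.
case: d => [[|e]|e].
(* At first index 0 the shift reads index -1, where the embedding is 0. *)
- by rewrite mulr0; case: j => *; rewrite ?mulr0 ?addr0.
- rewrite S; case: j => [k|k].
    rewrite T /= mulrA -rmorphM betaS /jacobi_step.
    (* For [k = 0] the weight from row -1 is 0, like the missing term of [jacobi_step]. *)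
    case: k => [|k]; first by rewrite /= !mul0r !add0r rmorphM mulrA.
    by rewrite S /= rmorphD !rmorphM /= mulrDl !mulrA.
  by rewrite /= !mul0r addr0.
- have -> : Negz e - 1 = Negz e.+1 by lia.
  by rewrite !mulr0 addr0.
Qed.

Lemma wshift_subnormal : subnormal (wshift a).
Proof.
exists (ell2 R), jacobi_shift, grid_embed.
have iso : forall x y, inner (grid_embed x) (grid_embed y) = inner x y.
  by apply: inner_of_norm => x; rewrite !ell2_inner_sum /= grid_embed_sum.
split=> //; first exact: jacobi_shift_normal.
  exact: isometry_closed.
exact: grid_embed_shift.
Qed.

End normal_extension.

(** * Moments of a weighted shift and Hankel positivity *)

Lemma inner_conj (R : realType) (H : hilbertType R) (x y : H) :
  inner x y = (inner y x)^*.
Proof. by rewrite [LHS]hermC expr0 mul1r. Qed.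

Lemma inner_sum (R : realType) (H : hilbertType R) n (c : nat -> R) (w : nat -> H) :
  inner (\sum_(s < n) (c s)%:C *: w s) (\sum_(s < n) (c s)%:C *: w s) =
  \sum_(s < n) \sum_(t < n) (c s * c t)%:C * inner (w s) (w t).
Proof.
rewrite linear_sumlz; apply: eq_bigr => s _.
rewrite linear_sumr; apply: eq_bigr => t _.
rewrite linearZl_LR linearZr_LR /= mulrA rmorphM; congr (_ * _ * _).
by apply/eqP; rewrite eq_complex /= oppr0 !eqxx.
Qed.

Section moments.
Context {R : realType}.
Local Notation C := R[i].
Implicit Types a : weight_seq R.

Lemma momentS a n : moment a n.+1 = moment a n * a n ^+ 2.
Proof. by rewrite /moment big_nat_recr. Qed.

Lemma moment0 a : moment a 0 = 1.
Proof. by rewrite /moment big_geq. Qed.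

Lemma moment_gt0 a n : 0 < moment a n.
Proof. by apply: prodr_gt0 => j _; rewrite exprn_gt0 ?weight_gt0. Qed.

Lemma moment_schur_power a p (p0 : 0 < p) n :
  moment (schur_power a p0) n = expR (p * ln (moment a n)).
Proof.
elim: n => [|n IH]; first by rewrite !moment0 ln1 mulr0 expR0.
rewrite !momentS {}IH lnM ?posrE ?exprn_gt0 ?moment_gt0 ?weight_gt0//.
rewrite mulrDr expRD; congr (_ * _).
rewrite lnXn ?weight_gt0// /= /powR gt_eqF ?weight_gt0//.
by rewrite expr2 -expRD; congr expR; ring.
Qed.

(** The Jacobi vectors have squared norms [moment a e]; divided by their norms they become the unit
    vectors [beta], consecutive norms having ratio [a e]. *)
Lemma subnormal_of_hankel a :
  (forall n, psd n (fun s t => moment a (s + t))) ->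
  (forall n, psd n (fun s t => moment a (s + t).+1)) -> subnormal (wshift a).
Proof.
move=> g0 g1; have [W aW] := weight_bounded a.
have W0 : 0 < W by rewrite (lt_le_trans (weight_gt0 a 0)).
have gW n : 0 <= moment a n <= W ^+ n.*2.
  rewrite ltW ?moment_gt0//=; elim: n => [|n IH]; first by rewrite moment0.
  rewrite momentS doubleS -[n.*2.+2]addn2 exprD; apply: ler_pM => //; rewrite ?sqr_ge0//.
    exact/ltW/moment_gt0.
  by rewrite ler_pXn2r ?nnegrE// ltW ?weight_gt0.
have [b [y [bW yS y_gt y1]]] := jacobi_of_moments W0 gW g0 g1.
(* The grid is countable, and infinite because its diagonal contains a copy of [nat]. *)
have /card_esym/card_set_bijP[enc] : ([set: nat] #= [set: int * int])%card.
  apply/card_esym/eq_card_nat => // fin; apply: infinite_nat.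
  rewrite -(preimage_setT (fun n => (Posz n, Posz n))).
  by apply: finite_preimage fin => m n _ _ [].
rewrite setTT_bijective => -[dec decK encK].
pose r n := Num.sqrt (moment a n).
have r0 n : 0 < r n by rewrite sqrtr_gt0 moment_gt0.
have rS n : r n.+1 = r n * a n.
  by rewrite /r momentS sqrtrM ?(ltW (moment_gt0 _ _))// sqrtr_sqr gtr0_norm ?weight_gt0.
apply: (@wshift_subnormal _ enc dec encK decK b W bW (fun e k => y e k / r e)).
- move=> e k; rewrite yS rS /jacobi_step invfM -!mulrA mulVf ?gt_eqF ?weight_gt0//.
  by rewrite mulr1 mulrDl; case: k => [|k]; rewrite ?mul0r -?mulrA.
- by move=> e k ek; rewrite y_gt ?mul0r.
- move=> e; under eq_bigr do rewrite expr_div_n.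
  by rewrite -mulr_suml y1 sqr_sqrtr ?(ltW (moment_gt0 _ _))// mulfV ?gt_eqF ?moment_gt0.
Qed.

Lemma ell2_basis_inner k :
  inner (ell2_basis k : ell2 R) (ell2_basis k) = 1.
Proof.
rewrite ell2_inner_sum; have -> : ell2_sum (ell2_basis k : ell2 R) = 1%E; last by [].
transitivity (\esum_(n in [set: nat]) if n \in [set k] then 1%E else 0%E : \bar R)%E.
  apply: eq_esum => n _ /=; have [->|/eqP nk] := eqVneq n k.
    by rewrite mem_set// Normc.normc1 expr1n.
  by rewrite memNset// Normc.normc0 expr0n.
by rewrite -esum_mkcond esum_set1.
Qed.

(** The entries are inner products of the vectors [w s] below, so the form is a squared norm. *)
Lemma hankel_of_subnormal a i n : subnormal (wshift a) ->
  psd n (fun s t => moment a (i + s + t)).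
Proof.
move=> [K [N [V [[_ [Ns [adjN NNs]]] iso _ VN]]]] c.
pose v := V (ell2_basis 0).
pose T x := Ns (N x).
have Nv k : inner (iter k N v) (iter k N v) = (moment a k)%:C.
  have -> : iter k N v = V (iter k (wshift a) (ell2_basis 0)).
    by elim: k => //= k ->; rewrite VN.
  rewrite iso; have -> : iter k (wshift a) (ell2_basis 0) =
      (\prod_(0 <= j < k) a j)%:C *: ell2_basis k.
    elim: k => [|k IH]; first by rewrite big_geq// scale1r.
    by rewrite iterS IH linearZ /= wshift_basis scalerA -rmorphM big_nat_recr.
  rewrite linearZl_LR linearZr_LR /= ell2_basis_inner mulr1 /moment.
  rewrite prodrXl.
  by apply/eqP; rewrite eq_complex /=; apply/andP; split; apply/eqP; ring.
have TN k x : iter k T (N x) = N (iter k T x).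
  by elim: k => //= k ->; rewrite /T NNs.
have adjE (x y : K) : inner (N x) y = inner x (Ns y) by exact: adjN.
have T1 x y : inner (T x) y = inner (N x) (N y).
  by rewrite inner_conj -adjE -inner_conj.
have Tadj k x y : inner (iter k T x) y = inner x (iter k T y).
  elim: k x y => // k IH x y; rewrite iterSr IH /= T1.
  by rewrite adjE.
(* [N] commutes with its adjoint, so the [k] factors on each side collect into the [k]-th power of
   [T]. *)
have NT k x : inner (iter k N x) (iter k N x) = inner x (iter k T x).
  elim: k x => // k IH x; rewrite iterSr IH TN adjE //.
have vT k : inner v (iter k T v) = (moment a k)%:C by rewrite -NT Nv.
(* Each side takes [i./2] of the offset; for odd [i] the extra [N] on each side makes one more
   [T]. *)
pose w s := if odd i then N (iter (s + i./2) T v) else iter (s + i./2) T v.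
have ww s t : inner (w s) (w t) = (moment a (i + s + t))%:C.
  have := odd_double_half i; rewrite /w; case: odd => iE.
    rewrite -T1 -iterS Tadj -iterD vT; congr (moment a _)%:C; lia.
  rewrite Tadj -iterD vT; congr (moment a _)%:C; lia.
have -> : kform n (fun s t => moment a (i + s + t)) c =
    complex.Re (inner (\sum_(s < n) (c s)%:C *: w s) (\sum_(s < n) (c s)%:C *: w s)).
  rewrite inner_sum raddf_sum; apply: eq_bigr => s _.
  rewrite raddf_sum; apply: eq_bigr => t _ /=.
  rewrite ww /=; ring.
rewrite inner_norm; have : 0 <= `|\sum_(s < n) (c s)%:C *: w s| ^+ 2 by [].
by rewrite lecE => /andP[].
Qed.

End moments.

(** * Moment infinite divisibility and conditional positivity of log-moments *)

Theorem corollary3p1 (R : realType) (a : weight_seq R) :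
  (MID a <->
   forall i k : nat, (1 <= k)%N -> cpd (log_mx (moment_mx a i k))) /\
  ((forall i k : nat, (1 <= k)%N -> cpd (log_mx (moment_mx a i k))) <->
   icpd (log_imx (moment_imx a 0)) /\ icpd (log_imx (moment_imx a 1))).
Proof.
split.
  apply: (iff_trans _ (iff_sym (cpd_log_momentsP a))); split=> [aMID i n|acpd p p0].
    (* The moments of the Schur power are [exp (p log gamma)], so subnormality for all [p > 0] makes
       these exponential kernels psd. *)
    apply: cpd_kernel_of_exp => p p0.
    move=> c; have := hankel_of_subnormal i n (aMID p p0) c.
    rewrite (eq_kform (B := fun s t => expR (p * log_moment_kernel a i s t)))//.
    by move=> s t _ _; exact: moment_schur_power.
  have H i n : psd n (fun s t => moment (schur_power a p0) (i + s + t)).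
    move=> c; rewrite (eq_kform (B := fun s t => expR (p * log_moment_kernel a i s t))).
      by apply: cpd_kernel_exp => //; [exact: log_moment_kernelC|exact: ltW].
    by move=> s t _ _; exact: moment_schur_power.
  by apply: subnormal_of_hankel; [exact: (H 0)|exact: (H 1)].
apply: (iff_trans (cpd_log_momentsP a)); split=> [acpd|[a0 a1]].
  by split; apply/icpd_log_momentsP.
by apply: cpd_log_moments01; exact/icpd_log_momentsP.
Qed.
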